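(* Let $k$ be a field, let $k[x_1,\ldots,x_n]$ and $k[y_1,\ldots,y_n]$ be polynomial rings, and suppose there is a matrix $(a_{ij})$ of non-negative integers with $\det(a_{ij})=\pm1$ such that $$x_i=\prod_{j=1}^n y_j^{a_{ij}}\qquad\text{for }1\le i\le n.$$ Let $R=k[x_1,\ldots,x_n]_{(x_1,\ldots,x_n)}$ and $S=k[y_1,\ldots,y_n]_{(y_1,\ldots,y_n)}$, so that $R\subset S$. Let $\nu$ be a rank $1$ valuation of $k(y_1,\ldots,y_n)$ whose valuation ring $V$ dominates $S$, such that $\nu(y_1),\ldots,\nu(y_n)$ are rationally independent. Then there exists a regular local ring $T$, dominated by $V$, with $R\subset S\subset T$, fitting into a commutative diagram $$\begin{array}{lllll} &&T&&\\ &\nearrow&&\nwarrow&\\ R&&\rightarrow&&S \end{array}$$ such that both inclusions $R\rightarrow T$ and $S\rightarrow T$ are products (finite compositions) of monoidal transforms along $\nu$.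
   Context: A local ring $(B,m_B)$ dominates a local ring $(A,m_A)$ if $A\subset B$ and $m_B\cap A=m_A$. A prime ideal $P$ of a regular local ring $R$ is called regular if $R/P$ is a regular local ring. Let $R$ be a regular local ring with quotient field $K$, and let $\nu$ be a valuation of $K$ whose valuation ring $V$ dominates $R$. A monoidal transform of $R$ along $\nu$ is a regular local ring $R(1)$ of the form $R(1)=R[\frac{P}{f}]_m$, where $P$ is a regular prime of $R$, $0\ne f\in P$ satisfies $\nu(f)=\min\{\nu(g)\mid g\in P\}$, and $m=\{g\in R[\frac{P}{f}]\mid \nu(g)>0\}$. Then $V$ dominates $R(1)$ and $R(1)$ dominates $R$. Rationally independent means linearly independent over $\mathbf Q$ (the value group of a rank $1$ valuation being regarded as a subgroup of $\mathbf R$). *)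

(* Defs.v *)
From HB Require Import structures.
From mathcomp Require Import all_boot all_order all_algebra.
From mathcomp Require Import mpoly.
From mathcomp Require Import boolp reals constructive_ereal.

Set Implicit Arguments.
Unset Strict Implicit.
Unset Printing Implicit Defensive.

Import Order.TTheory GRing.Theory Num.Theory.
Local Open Scope ring_scope.

(* In MathComp an [idealr B] is a proper ideal of B; ideals are boolean
   predicates, which is no restriction since [asbool] turns any predicate into
   a boolean one. *)

Definition generates (B : comNzRingType) (d : nat) (g : 'I_d -> B)
    (I : {pred B}) : Prop :=
  forall x, x \in I <-> exists c : 'I_d -> B, x = \sum_i c i * g i.

(* The unit ideal, generated by 1, need not be mentioned. *)
Definition noetherian (B : comNzRingType) : Prop :=
  forall I : idealr B, exists (d : nat) (g : 'I_d -> B), generates g I.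

Definition maximal_ideal (B : comNzRingType) (m : idealr B) : Prop :=
  forall I : idealr B, {subset m <= I} -> m =i I.

Definition local_ring (B : comNzRingType) (m : idealr B) : Prop :=
  maximal_ideal m /\ forall m' : idealr B, maximal_ideal m' -> m' =i m.

Definition has_prime_chain (B : comNzRingType) (d : nat) : Prop :=
  exists p : nat -> prime_idealr B, forall i, (i < d)%N ->
    {subset p i <= p i.+1} /\ ~ {subset p i.+1 <= p i}.

Definition krull_dim (B : comNzRingType) (d : nat) : Prop :=
  has_prime_chain B d /\ forall e, has_prime_chain B e -> (e <= d)%N.

Definition regular_local_ring (B : comNzRingType) : Prop :=
  noetherian B /\
  exists (m : idealr B) (d : nat),
    [/\ local_ring m, krull_dim B d & exists g : 'I_d -> B, generates g m].

Definition regular_prime (B : comNzRingType) (P : prime_idealr B) : Prop :=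
  regular_local_ring {ideal_quot P}.

(* The subring A of K as a ring in its own right. *)
Definition subring_of (K : fieldType) (A : subringClosed K) : Type :=
  {x : K | x \in A}.

Section SubringOf.
Variables (K : fieldType) (A : subringClosed K).
HB.instance Definition _ := SubChoice.on (subring_of A).
HB.instance Definition _ :=
  [SubChoice_isSubComNzRing of subring_of A by <:].
End SubringOf.

Definition dominates (K : fieldType) (B A : subringClosed K) : Prop :=
  {subset A <= B} /\
  exists (mA : idealr (subring_of A)) (mB : idealr (subring_of B)),
    [/\ local_ring mA, local_ring mB &
        forall (a : subring_of A) (b : subring_of B), val a = val b ->
          (b \in mB) = (a \in mA)].

Definition has_quotient_field (K : fieldType) (A : subringClosed K) : Prop :=
  forall x : K, exists a b : subring_of A, b != 0 /\ x = val a / val b.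

(* Valuations with values in the ordered group of the reals, extended by
   nu 0 = +oo. *)
Record real_valuation (K : fieldType) (RR : realType) := RealValuation {
  valuation_fun :> K -> \bar RR;
  valuation_fin : forall x, x != 0 -> valuation_fun x \is a fin_num;
  valuation0 : valuation_fun 0 = +oo%E;
  valuationM : forall x y,
    valuation_fun (x * y) = (valuation_fun x + valuation_fun y)%E;
  valuationD : forall x y,
    (Order.min (valuation_fun x) (valuation_fun y)
       <= valuation_fun (x + y))%E
}.

(* A valuation has rank 1 iff its value group is order isomorphic to a nonzero
   subgroup of the reals. *)
Definition rank_one (K : fieldType) (RR : realType)
    (nu : real_valuation K RR) : Prop :=
  exists2 x : K, x != 0 & nu x <> 0%E.

Section ValuationRing.
Variables (K : fieldType) (RR : realType) (nu : real_valuation K RR).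

Definition valuation_pred : {pred K} := fun x => (0 <= nu x)%E.

Lemma valuation_pred_subring : subring_closed valuation_pred.
Proof.
have nu1 : nu 1 = 0%E.
  have := valuationM nu 1 1; rewrite mulr1.
  have := valuation_fin nu (oner_neq0 K).
  by case: (nu 1) => // r _ [] /eqP; rewrite -subr_eq subrr => /eqP <-.
have nuN1 : nu (-1) = 0%E.
  have N1 : (-1 : K) != 0 by rewrite oppr_eq0 oner_neq0.
  have := valuationM nu (-1) (-1); rewrite mulrNN mulr1 nu1.
  have := valuation_fin nu N1.
  case: (nu (-1)) => // r _ [] /esym/eqP.
  by rewrite -mulr2n mulrn_eq0 /= => /eqP ->.
split; rewrite /valuation_pred.
- by rewrite unfold_in nu1.
- move=> x y; rewrite !unfold_in => x0 y0.
  apply: le_trans (valuationD nu x (- y)).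
  by rewrite le_min x0 -mulN1r valuationM nuN1 add0e.
- by move=> x y; rewrite !unfold_in valuationM => x0 y0; exact: adde_ge0.
Qed.

HB.instance Definition _ :=
  GRing.isSubringClosed.Build K valuation_pred valuation_pred_subring.

Definition valuation_ring : subringClosed K := valuation_pred.

End ValuationRing.

Section MonoidalTransform.
Variables (K : fieldType) (RR : realType) (nu : real_valuation K RR).

(* The ring R[P/f], the subring of K generated by R and the g/f with g in P. *)
Definition blowup_ring (R : subringClosed K) (P : {pred subring_of R})
    (f : subring_of R) (x : K) : Prop :=
  forall B : subringClosed K, {subset R <= B} ->
    (forall g, g \in P -> val g / val f \in B) -> x \in B.

(* The localization of R[P/f] at its prime m = {nu > 0}. *)
Definition blowup_local_ring (R : subringClosed K) (P : {pred subring_of R})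
    (f : subring_of R) (x : K) : Prop :=
  exists a b : K,
    [/\ blowup_ring P f a, blowup_ring P f b, ~ (0 < nu b)%E & x = a / b].

Definition monoidal_transform (R R1 : subringClosed K) : Prop :=
  [/\ regular_local_ring (subring_of R), has_quotient_field R,
      dominates (valuation_ring nu) R,
      regular_local_ring (subring_of R1) &
      exists (P : prime_idealr (subring_of R)) (f : subring_of R),
        [/\ regular_prime P,
            f != 0 /\ f \in P,
            forall g, g \in P -> (nu (val f) <= nu (val g))%E &
            forall x, x \in R1 <-> blowup_local_ring P f x]].

Inductive monoidal_product : subringClosed K -> subringClosed K -> Prop :=
| monoidal_nil (R R1 : subringClosed K) : R =i R1 -> monoidal_product R R1
| monoidal_cons (R R1 R2 : subringClosed K) :
    monoidal_transform R R1 -> monoidal_product R1 R2 -> monoidal_product R R2.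

End MonoidalTransform.

(* For elements z_1, ..., z_n of an extension K of k, algebraically independent
   over k, [poly_local iota z] is k[z_1, ..., z_n] localized at
   (z_1, ..., z_n), viewed inside K: a polynomial q is outside the ideal of the
   variables iff its constant coefficient is nonzero. The condition q(z) != 0
   then holds automatically; it makes [poly_local iota z] a ring for all z. *)
Section PolyLocal.
Variables (k K : fieldType) (iota : {rmorphism k -> K}).
Variables (n : nat) (z : 'I_n -> K).

Definition poly_local_pred : {pred K} := fun w =>
  `[< exists p q : {mpoly k[n]},
        [/\ q@_0%MM != 0, mmap iota z q != 0 &
            w = mmap iota z p / mmap iota z q] >].

Lemma poly_local_subring : subring_closed poly_local_pred.
Proof.
have c0M (p q : {mpoly k[n]}) : (p * q)@_0%MM = p@_0%MM * q@_0%MM.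
  exact: rmorphM.
split.
- have z1 : mmap iota z 1 = 1 by exact: rmorph1.
  by apply/asboolP; exists 1, 1; rewrite mcoeff1 eqxx z1 divr1 !oner_neq0.
- move=> _ _ /asboolP[p [q [q0 qz ->]]] /asboolP[p' [q' [q'0 q'z ->]]].
  apply/asboolP; exists (p * q' - p' * q), (q * q').
  rewrite c0M rmorphB !rmorphM /= !mulf_neq0 //; split=> //.
  by rewrite -(mulNr _ (mmap iota z q')^-1) addf_div // mulNr.
- move=> _ _ /asboolP[p [q [q0 qz ->]]] /asboolP[p' [q' [q'0 q'z ->]]].
  apply/asboolP; exists (p * p'), (q * q').
  by rewrite c0M !rmorphM /= !mulf_neq0 //; split=> //; rewrite mulf_div.
Qed.

HB.instance Definition _ :=
  GRing.isSubringClosed.Build K poly_local_pred poly_local_subring.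

Definition poly_local : subringClosed K := poly_local_pred.

End PolyLocal.

Definition rationally_independent (RR : realType) (n : nat) (t : 'I_n -> RR) :
    Prop :=
  forall c : 'I_n -> rat, \sum_i ratr (c i) * t i = 0 -> forall i, c i = 0.

Definition frac_const (k : fieldType) (n : nat) :
    {rmorphism k -> {fraction {mpoly k[n]}}} :=
  @tofrac {mpoly k[n]} \o @mpolyC n k.

(* Main.v *)
Require Import Defs.
From HB Require Import structures.
From mathcomp Require Import all_boot all_order all_algebra.
From mathcomp Require Import mpoly.
From mathcomp Require Import boolp reals constructive_ereal.
From mathcomp Require Import zify ring lra.
Set Implicit Arguments.
Unset Strict Implicit.
Unset Printing Implicit Defensive.
Import Order.TTheory GRing.Theory Num.Theory.
Local Open Scope ring_scope.

(** A monoidal transform of the local ring of z_1, ..., z_n at an ideal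
    (z_i, z_j) with nu z_j < nu z_i replaces z_i by z_i / z_j.  As the values are
    rationally independent, Laurent monomials are determined by their values, so
    such a transform is a subtraction x := x - y with y < x in the list of
    values.  The values of the x_i and those of the y_j are positive bases of the
    same subgroup G of the reals, and it suffices to bring two such bases to a
    common one by subtractions of smaller elements from larger ones.

    By Dirichlet's theorem there is a nonzero homomorphism l : G -> Z with
    |l w - lam * w| < 1/2 on both bases for some lam > 0.  In a basis of at least
    three elements, two have defects l w - lam * w of the same sign, and
    subtracting the smaller from the larger keeps all defects below 1/2; this
    continues until a single element z has a nonzero label.  The other elements
    then form a basis of the kernel of l.  Doing this for both bases, the kernel
    parts are joined by induction on the rank, and the two elements z and z'
    differ by an element of the kernel, which Perron's algorithm turns into a
    nonnegative combination of basis elements, to be subtracted.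

    That the rings so obtained are regular of dimension n comes from Dickson's
    lemma (finiteness of ideals) and from counting monomials: a chain of primes of
    length n + 1 would give n + 1 algebraically independent elements in a field of
    transcendence degree n. *)

(** * Subtraction moves on positive bases *)

Lemma perm_swap (T : eqType) (x y : T) s : perm_eq (x :: y :: s) (y :: x :: s).
Proof. exact/permPl/(perm_catCA [:: x] [:: y]). Qed.

Section IntegerSpan.
Variable V : zmodType.
Implicit Types (s t : seq V) (x y : V).

(** The subgroup generated by [s], with one generator peeled off at a time so that proofs go by
    recursion on the list. *)
Fixpoint zspan s x : Prop :=
  if s is y :: s' then exists n : int, zspan s' (x - y *~ n) else x = 0.

Lemma zspan0 s : zspan s 0.
Proof. by elim: s => //= y s IH; exists 0; rewrite mulr0z subr0. Qed.

Lemma zspanD s x y : zspan s x -> zspan s y -> zspan s (x + y).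
Proof.
elim: s x y => [|z s IH] x y /=; first by move=> -> ->; rewrite addr0.
move=> [n xn] [m ym]; exists (n + m).
by rewrite mulrzDr opprD addrACA; apply: IH.
Qed.

Lemma zspanN s x : zspan s x -> zspan s (- x).
Proof.
elim: s x => [|z s IH] x /=; first by move=> ->; rewrite oppr0.
by move=> [n /IH]; exists (- n); rewrite mulrNz -opprD.
Qed.

Lemma zspanB s x y : zspan s x -> zspan s y -> zspan s (x - y).
Proof. by move=> sx /zspanN; apply: zspanD. Qed.

Lemma zspanMz s x n : zspan s x -> zspan s (x *~ n).
Proof.
move=> sx; have natP k : zspan s (x *+ k).
  by elim: k => [|k IH]; rewrite ?mulr0n ?mulrS; [exact: zspan0|exact: zspanD].
case: n => n; first by rewrite -pmulrn.
by rewrite NegzE mulrNz -pmulrn; apply: zspanN.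
Qed.

Lemma zspan_cons s x y : zspan s x -> zspan (y :: s) x.
Proof. by exists 0; rewrite mulr0z subr0. Qed.

Lemma zspan_mem s x : x \in s -> zspan s x.
Proof.
elim: s => //= y s IH; rewrite inE => /orP[/eqP->|/IH/(@zspan_cons _ _ y)//].
by exists 1; rewrite mulr1z subrr; apply: zspan0.
Qed.

Lemma zspan_sub s t x : (forall y, y \in s -> zspan t y) -> zspan s x ->
  zspan t x.
Proof.
elim: s x => [|y s IH] x st /=; first by move=> ->; apply: zspan0.
move=> [n /IH sx]; rewrite -(subrK (y *~ n) x); apply: zspanD.
  by apply: sx => z zs; apply: st; rewrite inE zs orbT.
by apply: zspanMz; apply: st; rewrite mem_head.
Qed.

Lemma zspan_subset s t x : {subset s <= t} -> zspan s x -> zspan t x.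
Proof. by move=> st; apply: zspan_sub => y /st; apply: zspan_mem. Qed.

Lemma zspan_perm s t x : perm_eq s t -> zspan s x <-> zspan t x.
Proof.
by move=> /perm_mem st; split; apply: zspan_subset => y; rewrite st.
Qed.

Lemma zspan_step s x y z : zspan (x - y :: y :: s) z <-> zspan (x :: y :: s) z.
Proof.
have E n m : z - (x - y) *~ n - y *~ m = z - x *~ n - y *~ (m - n).
  by rewrite mulrzBl mulrzBr !opprB !addrA (addrAC z).
split=> -[n [m szn]]; first by exists n, (m - n); rewrite -E.
by exists n, (m + n); rewrite E addrK.
Qed.

(** Linear independence over the integers without coefficient vectors; quantifying over the
    rearrangements [x :: t] lets any entry be singled out. *)
Definition zfree s := forall x t, perm_eq s (x :: t) ->
  forall n, zspan t (x *~ n) -> n = 0.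

Lemma zfree_perm s t : perm_eq s t -> zfree s -> zfree t.
Proof. by move=> st sf x u tu; apply: sf; apply: perm_trans st tu. Qed.

Lemma zfree_cons s x : zfree (x :: s) -> zfree s.
Proof.
move=> sf y t st n tn; apply: (sf y (x :: t)); last exact: zspan_cons.
by rewrite perm_sym (permPl (perm_swap _ _ _)) perm_cons perm_sym.
Qed.

Lemma zfree_neq s x y : zfree (x :: y :: s) -> x != y.
Proof.
move=> sf; apply/eqP => xy; have := sf x (y :: s) (perm_refl _) 1.
by rewrite mulr1z xy => /(_ (zspan_mem (mem_head _ _))).
Qed.

(** If a relation for an entry [y] of [s] involves [x] with coefficient [m], then [x *~ m] lies in
    the span of [s]; so [m] vanishes and the relation lives inside [s]. *)
Lemma zfree_consP s x :
  zfree (x :: s) <-> (forall n, zspan s (x *~ n) -> n = 0) /\ zfree s.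
Proof.
split=> [sf|[xf sf] y t xyt n].
  by split; [exact: sf|exact: zfree_cons sf].
have [yx|yx] := eqVneq y x.
  by move: xyt; rewrite yx perm_cons => /zspan_perm <- /xf.
have ys : y \in s.
  by have := mem_head y t; rewrite -(perm_mem xyt) inE (negPf yx).
have /zspan_perm <- : perm_eq (x :: rem y s) t.
  rewrite -(perm_cons y) -(permPr xyt).
  rewrite (permPl (perm_swap _ _ _)) perm_cons.
  by rewrite perm_sym perm_to_rem.
case=> m symx; have m0 : m = 0.
  apply: xf; apply/(zspan_perm _ (perm_to_rem ys)).
  by exists n; rewrite -opprB; apply: zspanN.
by move: symx; rewrite m0 mulr0z subr0; apply: sf; apply: perm_to_rem.
Qed.

Lemma zfree_step s x y : zfree (x :: y :: s) -> zfree (x - y :: y :: s).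
Proof.
move=> /zfree_consP[xf yf]; apply/zfree_consP; split=> // n [m smn].
apply: xf; exists (m + n).
by move: smn; rewrite mulrzBl mulrzDr opprD addrA addrAC.
Qed.

End IntegerSpan.

Lemma zspan_map (V W : zmodType) (h : {additive V -> W}) s x :
  zspan s x -> zspan (map h s) (h x).
Proof.
elim: s x => [|y s IH] x /=; first by move=> ->; rewrite raddf0.
by move=> [n /IH]; exists n; rewrite -raddfMz -raddfB.
Qed.

Section Reach.
Variables (R : numDomainType) (V : zmodType) (phi : {additive V -> R}).
Implicit Types (s t u : seq V) (x y z : V).

(** Sizes are compared through [phi], so that the same moves apply to real numbers and to real
    numbers carrying a label. *)
Inductive reach : seq V -> seq V -> Prop :=
| reach_perm s t : perm_eq s t -> reach s t
| reach_sub s t u x y : perm_eq s (x :: y :: t) -> phi y < phi x ->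
    reach (x - y :: y :: t) u -> reach s u.

Lemma reach_refl s : reach s s.
Proof. exact: reach_perm. Qed.

Lemma reach_permL s t u : perm_eq s t -> reach t u -> reach s u.
Proof.
move=> st tu; case: tu st => {t u} [t u tu|t t' u x y txy yx t'u] st.
  exact/reach_perm/(perm_trans st).
exact: reach_sub (perm_trans st txy) yx t'u.
Qed.

Lemma reach_trans s t u : reach s t -> reach t u -> reach s u.
Proof.
elim=> {s t} [s t st|s t' t x y sxy yx _ IH tu]; first exact: reach_permL.
exact: reach_sub sxy yx (IH tu).
Qed.

Lemma reach_cons z s u : reach s u -> reach (z :: s) (z :: u).
Proof.
elim=> {s u} [s u su|s t u x y sxy yx _ IH].
  by apply: reach_perm; rewrite perm_cons.
have E x' y' : perm_eq (z :: [:: x', y' & t]) [:: x', y', z & t].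
  exact/permPl/(perm_catCA [:: z] [:: x'; y']).
apply: (@reach_sub _ (z :: t) _ x y _ yx).
  by rewrite (perm_trans _ (E x y)) // perm_cons.
by apply: reach_permL IH; rewrite perm_sym.
Qed.

Lemma reach_step x y s : phi y < phi x -> reach (x :: y :: s) (x - y :: y :: s).
Proof. by move=> yx; apply: reach_sub (perm_refl _) yx (reach_refl _). Qed.

Lemma reach_size s u : reach s u -> size s = size u.
Proof. by elim=> {s u} [s u /perm_size|s t u x y /perm_size -> _ _]. Qed.

Lemma reach_zspan s u x : reach s u -> zspan s x <-> zspan u x.
Proof.
elim=> {s u} [s u su|s t u y z syz _ _ <-]; first exact: zspan_perm.
by rewrite zspan_step; apply: zspan_perm.
Qed.

Lemma reach_zfree s u : reach s u -> zfree s -> zfree u.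
Proof.
elim=> {s u} [s u su|s t u y z syz _ _ IH sf]; first exact: zfree_perm.
by apply/IH/zfree_step/(zfree_perm syz).
Qed.

Lemma reach_pos s u : reach s u -> all (fun x => 0 < phi x) s ->
  all (fun x => 0 < phi x) u.
Proof.
elim=> {s u} [s u su|s t u x y sxy yx _ IH]; first by rewrite (perm_all _ su).
rewrite (perm_all _ sxy) => /= /and3P[x0 y0 t0]; apply: IH => /=.
by rewrite raddfB subr_gt0 yx y0.
Qed.

Inductive nspan s : V -> Prop :=
| nspan0 : nspan s 0
| nspan_add x y : x \in s -> nspan s y -> nspan s (x + y).

Lemma nspanD s x y : nspan s x -> nspan s y -> nspan s (x + y).
Proof.
move=> + sy; elim=> {x} [|x z xs _ IH]; first by rewrite add0r.
by rewrite -addrA; apply: nspan_add.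
Qed.

Lemma nspan_mem s x : x \in s -> nspan s x.
Proof. by move=> xs; rewrite -[x]addr0; apply: nspan_add xs (nspan0 _). Qed.

Lemma nspanMn s x n : nspan s x -> nspan s (x *+ n).
Proof.
move=> sx; elim: n => [|n IH]; first by rewrite mulr0n; apply: nspan0.
by rewrite mulrS; apply: nspanD.
Qed.

Lemma nspan_sub s t x : (forall y, y \in s -> nspan t y) -> nspan s x ->
  nspan t x.
Proof.
move=> st; elim=> {x} [|x y xs _ IH]; first exact: nspan0.
by apply: nspanD => //; apply: st.
Qed.

(** A move only enlarges the generated monoid, because the lost entry [x] is the sum of [x - y] and
    [y]. *)
Lemma reach_nspan s u x : reach s u -> nspan s x -> nspan u x.
Proof.
move=> su; elim: su x => {s u} [s u /perm_mem su|s t u x y sxy _ _ IH] z.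
  by apply: nspan_sub => x; rewrite su; apply: nspan_mem.
move=> sz; apply: IH; apply: nspan_sub sz => w; rewrite (perm_mem sxy).
rewrite inE => /orP[/eqP->|wt].
  have : nspan (x - y :: y :: t) (x - y + y).
    by apply: nspanD; apply: nspan_mem; rewrite !inE eqxx ?orbT.
  by rewrite subrK.
by apply: nspan_mem; rewrite inE wt orbT.
Qed.

Lemma nspan_ge0 s x : all (fun x => 0 < phi x) s -> nspan s x -> 0 <= phi x.
Proof.
move=> /allP s0; elim=> {x} [|x y /s0 x0 _ y0]; first by rewrite raddf0.
by rewrite raddfD addr_ge0 // ltW.
Qed.

(** The summands of [y] are subtracted one by one. Each is smaller than the first entry, which still
    contains the positive [x] besides it. *)
Lemma reach_subn s x y : all (fun x => 0 < phi x) (x :: s) -> nspan s y ->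
  reach (x + y :: s) (x :: s).
Proof.
move=> /= /andP[x0 s0]; elim=> {y} [|z y zs ys IH].
  by rewrite addr0; apply: reach_refl.
apply: (@reach_sub _ (rem z s) _ (x + (z + y)) z).
- by rewrite perm_cons perm_to_rem.
- by rewrite addrCA raddfD ltrDl raddfD ltr_pwDl // (nspan_ge0 s0).
- rewrite addrCA addrAC subrr add0r; apply: reach_permL IH.
  by rewrite perm_cons perm_sym perm_to_rem.
Qed.

End Reach.

(** Used with [fst] to forget labels after moves on labelled elements. *)
Lemma reach_map (R : numDomainType) (V W : zmodType) (phi : {additive V -> R})
    (psi : {additive W -> R}) (h : {additive V -> W}) s u :
  (forall x, psi (h x) = phi x) -> reach phi s u ->
  reach psi (map h s) (map h u).
Proof.
move=> hE; elim=> {s u} [s u su|s t u x y sxy yx _ IH].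
  by apply: reach_perm; rewrite perm_map.
apply: (@reach_sub _ _ _ _ (map h t) _ (h x) (h y)).
- by rewrite -[_ :: _]/(map h (x :: y :: t)) perm_map.
- by rewrite !hE.
- by move: IH; rewrite /= raddfB.
Qed.

(** * Perron's algorithm *)

Section Join.
Variable R : archiRealFieldType.
Implicit Types (s t u : seq R) (x y : R).

Local Notation idR := (idfun : {additive R -> R}).
Local Notation reachR := (reach idR).
Local Notation fstR := (fst : {additive R * int -> R}).
Local Notation reachL := (reach fstR).

Lemma reachR_step s t x y : perm_eq s (x :: y :: t) -> y < x ->
  reachR s (x - y :: y :: t).
Proof.
by move=> sxy yx; apply: (reach_sub (phi := idR)) sxy yx (reach_refl _ _).
Qed.

(** Here a pair is a generator with its coefficient in a formal combination, not an element with a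
    label as further below. *)
Definition value (K : seq (R * int)) : R := \sum_(z <- K) z.1 *~ z.2.
Definition positive_part (K : seq (R * int)) : nat :=
  (\sum_(z <- K) `|Num.max z.2 0|)%N.

Lemma value_perm K L : perm_eq K L -> value K = value L.
Proof. exact: perm_big. Qed.

Lemma nspan_value K : all (fun z => 0 <= z.2) K -> nspan (map fst K) (value K).
Proof.
elim: K => [|[x c] K IH] /=; first by rewrite /value big_nil => _; apply: nspan0.
case/andP=> c0 /IH sK; rewrite /value big_cons; apply: nspanD.
  case: c c0 => // c _; rewrite -pmulrn.
  by apply/nspanMn/nspan_mem; rewrite mem_head.
by apply: nspan_sub sK => y yK; apply: nspan_mem; rewrite inE yK orbT.
Qed.

(* The measure that decreases is lexicographic: the most negative coefficient,
   its multiplicity, then the sum of the positive coefficients. *)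
Lemma perron_rec q : forall K, zfree (map fst K) ->
  all (fun x => 0 < x) (map fst K) -> all (fun z => - q%:Z <= z.2) K ->
  0 < value K ->
  exists2 u, reachR (map fst K) u & nspan u (value K).
Proof.
elim: q => [|q IHq] K.
  move=> _ _ Kq _; exists (map fst K); first exact: reach_refl.
  exact: nspan_value.
have [a] := ubnP (count (fun z => z.2 == - q.+1%:Z) K).
elim: a K => // a IHa K.
have [p] := ubnP (positive_part K).
elim: p K => // p IHp K Kp Ka Kf K0 Kq vK.
(* If the minimal coefficient [- q.+1] does not occur, the bound improves to [- q]. *)
have [minK|] := boolP (has (fun z => z.2 == - q.+1%:Z) K); last first.
  rewrite -all_predC => Kq'; apply: IHq => //; apply/allP => z zK.
  by move/allP/(_ z zK): Kq; move/allP/(_ z zK): Kq' => /=; lia.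
case/hasP: minK => -[y c] yK /= /eqP cE; subst c.
have Ky := perm_to_rem yK; set K1 := rem _ K in Ky.
(* Without a positive coefficient the value could not be positive. *)
have [posK|] := boolP (has (fun z => 0 < z.2) K1); last first.
  rewrite -all_predC => /allP K1neg; move: vK; rewrite (value_perm Ky).
  rewrite /value big_cons ltNge /= => /negP[]; rewrite -oppr_ge0 opprD.
  have pos z : z \in K -> 0 < z.1.
    by move=> zK; move/allP: K0; apply; apply: map_f.
  rewrite addr_ge0 //; first by rewrite mulrNz opprK mulrz_ge0 // ltW // (pos _ yK).
  rewrite oppr_ge0 big_seq sumr_le0 // => z zK; rewrite mulrz_ge0_le0 //.
    by apply/ltW/pos; rewrite (perm_mem Ky) inE zK orbT.
  by have := K1neg z zK; rewrite /= -leNgt.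
case/hasP: posK => -[x c] xK /= c0.
have K1x := perm_to_rem xK; set K2 := rem _ K1 in K1x.
have {Ky K1x} KE : perm_eq K ((y, - q.+1%:Z) :: (x, c) :: K2).
  by rewrite (perm_trans Ky) // perm_cons.
have /= fKE := perm_map fst KE.
move: (Kf) K0 Kq; rewrite (perm_all _ fKE) (perm_all _ KE).
move=> /(zfree_perm fKE) /= Kf' /and3P[y0 x0 K20] /and3P[_ cq K2q].
move: Ka Kp; rewrite (permP KE) /positive_part (perm_big _ KE) /= !big_cons /=.
have cN : (c == - q.+1%:Z) = false by move: c0; clear; lia.
have cBN : (c - q.+1%:Z == - q.+1%:Z) = false by move: c0; clear; lia.
rewrite eqxx cN add0n add1n ltnS => Ka Kp.
have vKE : value K = y *~ (- q.+1%:Z) + (x *~ c + value K2).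
  by rewrite (value_perm KE) /value !big_cons.
have step (K' : seq (R * int)) : value K' = value K ->
    reachR (map fst K) (map fst K') ->
    (exists2 u, reachR (map fst K') u & nspan u (value K')) ->
    exists2 u, reachR (map fst K) u & nspan u (value K).
  by move=> -> KK' [u K'u su]; exists u => //; apply: reach_trans KK' K'u.
(* If [y < x], then with [x - y] in place of [x] the coefficient of [y] becomes [c - q.+1], so one
   minimal coefficient disappears. *)
have := zfree_neq Kf'; rewrite neq_lt => /orP[yx|xy].
  pose K' := (x - y, c) :: (y, c - q.+1%:Z) :: K2.
  have vK' : value K' = value K.
    by rewrite vKE /value !big_cons /= mulrzBl mulrzBr mulrNz; ring.
  have KK' : reachR (map fst K) (map fst K').
    apply: reachR_step yx.
    by rewrite (perm_trans fKE) // perm_swap.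
  apply: (step K') => //; apply: IHa; rewrite ?vK' //=.
  - by rewrite cN cBN.
  - exact: (reach_zfree KK' Kf).
  - by rewrite subr_gt0 yx y0.
  - by rewrite K2q; move: c0 cq; clear; lia.
(* If [x < y], the number of minimal coefficients is unchanged, but the positive coefficient of [x]
   decreases. *)
pose K' := (y - x, - q.+1%:Z) :: (x, c - q.+1%:Z) :: K2.
have vK' : value K' = value K.
  by rewrite vKE /value !big_cons /= mulrzBl mulrzBr !mulrNz; ring.
have KK' : reachR (map fst K) (map fst K').
  exact: reachR_step fKE xy.
apply: (step K') => //; apply: IHp; rewrite ?vK' //=.
- by move: Kp c0; rewrite /positive_part !big_cons /=; clear; lia.
- by rewrite eqxx cBN add0n add1n ltnS.
- exact: (reach_zfree KK' Kf).
- by rewrite subr_gt0 xy x0.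
- by rewrite K2q; move: c0 cq; clear; lia.
Qed.

Lemma zspan_lin s x : zspan s x ->
  exists2 K : seq (R * int), map fst K = s & x = value K.
Proof.
elim: s x => [|y s IH] x /=.
  by move=> ->; exists [::] => //; rewrite /value big_nil.
case=> n /IH[K <- xK]; exists ((y, n) :: K) => //.
by rewrite /value big_cons /= -/(value K) -xK addrC subrK.
Qed.

Lemma perron s x : zfree s -> all (fun x => 0 < x) s -> zspan s x -> 0 <= x ->
  exists2 u, reachR s u & nspan u x.
Proof.
move=> sf s0 /zspan_lin[K Ks ->]; rewrite le_eqVlt => /orP[/eqP <-|vK].
  by exists s; [apply: reach_refl | apply: nspan0].
rewrite -Ks in sf s0 *.
(* A crude bound: the sum of all absolute values exceeds each of them. *)
apply: (@perron_rec (\sum_(z <- K) `|z.2|)%N) => //; apply/allP => z zK.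
rewrite (big_rem z zK) /=; lia.
Qed.

(** * Bases of at most two elements *)

Lemma sub_comb x y (a b c d : int) :
  x *~ a + y *~ b - (x *~ c + y *~ d) = x *~ (a - c) + y *~ (b - d).
Proof. by rewrite !mulrzBr; ring. Qed.

(** From [(c + 1) * (b + 1) <= a * d <= b * c + 1] follows [b + c <= 0], and then [a * d <= 1]. *)
Lemma unimodular2_extremal (a b c d : int) : 0 <= b -> 0 <= c -> c < a -> b < d ->
  a * d <= b * c + 1 -> [/\ a = 1, b = 0, c = 0 & d = 1].
Proof.
move=> b0 c0 ca bd adbc.
have le : (c + 1) * (b + 1) <= a * d by apply: ler_pM; lia.
have [bE cE] : b = 0 /\ c = 0 by move: le adbc b0 c0; clear; nia.
by subst b c; split=> //; move: adbc ca bd; clear; nia.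
Qed.

(* If no row of a nonnegative matrix of determinant 1 or -1 dominates the other
   one, then the matrix is a permutation matrix. *)
Lemma reach_unimodular2 x y (a b c d : int) : 0 < x -> 0 < y ->
  0 <= a -> 0 <= b -> 0 <= c -> 0 <= d ->
  (a * d - b * c == 1) || (a * d - b * c == -1) ->
  reachR [:: x *~ a + y *~ b; x *~ c + y *~ d] [:: x; y].
Proof.
move=> x0 y0; have [x0' y0'] := (ltW x0, ltW y0); have [N] := ubnP (`|a| + `|b| + `|c| + `|d|)%N.
elim: N a b c d => // N IHN a b c d abcd a0 b0 c0 d0 D.
wlog cd_ab : a b c d abcd a0 b0 c0 d0 D /
    x *~ c + y *~ d <= x *~ a + y *~ b => [wl|].
  have [|ab_cd] := leP (x *~ c + y *~ d) (x *~ a + y *~ b); first exact: wl.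
  apply: reach_permL (perm_swap _ _ _) _; apply: wl => //; last exact: ltW.
    by move: abcd; clear; lia.
  by move: D; clear; lia.
have ac_bd : (c <= a) && (d <= b) || (c < a) && (b < d) || (a < c) && (d < b)
    || (a <= c) && (b <= d) by clear; lia.
(* If the first row dominates, subtracting the second lowers the sum of the entries. Crossing rows
   form a permutation matrix. If the second row dominates, the order of the values forces equal rows
   and determinant 0. *)
case/orP: ac_bd => [/orP[/orP[]|]|] /andP[h1 h2].
- have D0 : 0 < c + d.
    rewrite lt_neqAle addr_ge0 // andbT eq_sym paddr_eq0 //.
    by apply/negP => /andP[/eqP cE /eqP dE]; move: D; rewrite cE dE !mulr0.
  have cd0 : 0 < x *~ c + y *~ d.
    have [c1|] := ltP 0 c; first by rewrite ltr_pwDl ?mulrz_ge0 ?pmulrz_rgt0.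
    move=> c1; rewrite ltr_wpDl ?mulrz_ge0 ?pmulrz_rgt0 //.
    by move: D0 c1; clear; lia.
  have := cd_ab; rewrite le_eqVlt => /orP[/eqP cdab|lt_cd_ab].
    have /eqP := subrr (x *~ a + y *~ b); rewrite -{2}cdab sub_comb.
    have ac0 : 0 <= a - c by rewrite subr_ge0.
    have bd0 : 0 <= b - d by rewrite subr_ge0.
    rewrite paddr_eq0 ?mulrz_ge0 // !mulrz_eq0 (gt_eqF x0) (gt_eqF y0) /=.
    by move=> /andP[/eqP ac /eqP bd]; exfalso; move: D ac bd; clear; nia.
  apply: reach_trans (reach_step (phi := idR) [::] lt_cd_ab) _.
  rewrite sub_comb; apply: IHN; rewrite ?subr_ge0 //.
    by move: abcd D0 h1 h2 c0 d0 a0 b0; clear; lia.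
  by move: D; clear; rewrite !mulrBl; congr (is_true (_ || _)); congr (_ == _); ring.
- have [-> -> -> ->] : [/\ a = 1, b = 0, c = 0 & d = 1].
    have [] := unimodular2_extremal b0 c0 h1 h2; last by [].
    by move: D; clear; lia.
  by rewrite !mulr0z !mulr1z addr0 add0r; apply: reach_refl.
- have [-> -> -> ->] : [/\ a = 0, b = 1, c = 1 & d = 0].
    have [] := unimodular2_extremal a0 d0 h2 h1; last by [].
    by move: D; clear; lia.
  by rewrite !mulr0z !mulr1z addr0 add0r; apply/reach_perm/perm_swap.
- exfalso; move: cd_ab; rewrite -subr_le0 sub_comb.
  have ca0 : 0 <= c - a by rewrite subr_ge0.
  have db0 : 0 <= d - b by rewrite subr_ge0.
  rewrite le_eqVlt ltNge addr_ge0 ?mulrz_ge0 //= orbF.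
  rewrite paddr_eq0 ?mulrz_ge0 // !mulrz_eq0 (gt_eqF x0) (gt_eqF y0) /=.
  by move=> /andP[/eqP ac /eqP bd]; move: D ac bd; clear; nia.
Qed.

Lemma zspan_pair x y z : zspan [:: x; y] z ->
  exists a b : int, z = x *~ a + y *~ b.
Proof. by case=> a [b /eqP]; rewrite -addrA -opprD subr_eq0 => /eqP ->; exists a, b. Qed.

Lemma nspan_pair x y z : nspan [:: x; y] z ->
  exists a b : int, [/\ 0 <= a, 0 <= b & z = x *~ a + y *~ b].
Proof.
elim=> {z} [|u z + _ [a [b [a0 b0 ->]]]].
  by exists 0, 0; rewrite !mulr0z addr0.
rewrite !inE => /orP[]/eqP ->.
  exists (a + 1), b; rewrite addr_ge0 //; split=> //.
  by rewrite mulrzDr mulr1z addrA [x + _]addrC.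
exists a, (b + 1); rewrite addr_ge0 //; split=> //.
by rewrite mulrzDr mulr1z addrCA [y + _]addrC.
Qed.

Definition joinable s t := exists u, reachR s u /\ reachR t u.

Lemma join1 x y : 0 < x -> 0 < y -> zspan [:: y] x -> zspan [:: x] y -> x = y.
Proof.
move=> x0 y0 [n /eqP]; rewrite subr_eq0 => /eqP xE [m /eqP].
rewrite subr_eq0 => /eqP yE.
have n0 : 0 < n by move: x0; rewrite xE pmulrz_rgt0.
have m0 : 0 < m by move: y0; rewrite yE pmulrz_rgt0.
have /eqP : x *~ (m * n - 1) = 0.
  by rewrite mulrzBr mulr1z mulrzA -yE -xE subrr.
rewrite mulrz_eq0 (gt_eqF x0) orbF subr_eq0 => /eqP mn.
by rewrite xE; have -> : n = 1 by move: n0 m0 mn; clear; nia.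
Qed.

(** Perron's algorithm, run once for each element of [t], turns [s] into a basis in which both have
    nonnegative coefficients; [reach_nspan] protects the first during the second run. Then
    [reach_unimodular2] leads from [t] to that basis. *)
Lemma join2 s t : size s = 2%N -> size t = 2%N -> zfree s ->
  all (fun x => 0 < x) s -> all (fun x => 0 < x) t ->
  (forall x, zspan s x <-> zspan t x) -> joinable s t.
Proof.
move=> s2 t2 sf s0 t0 st.
case: t t2 t0 st => [|t1 [|t2 []]] // _ t0 st; have /= /and3P[t10 t20 _] := t0.
have [u su ut1] : exists2 u, reachR s u & nspan u t1.
  apply: perron => //; last exact: ltW.
  by apply: (st _).2; apply: zspan_mem; rewrite inE eqxx.
have [v uv vt2] : exists2 v, reachR u v & nspan v t2.
  apply: perron; rewrite ?(reach_pos su) //; [exact: (reach_zfree su)| |exact: ltW].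
  by apply: (reach_zspan _ su).1; apply: (st _).2; apply: zspan_mem; rewrite !inE eqxx orbT.
have vt1 := reach_nspan uv ut1; have {su uv} sv := reach_trans su uv.
have v0 := reach_pos sv s0; have vf := reach_zfree sv sf.
have vt x : zspan v x <-> zspan [:: t1; t2] x by rewrite -st -(reach_zspan _ sv).
have := reach_size sv; rewrite s2; case: v => [|x [|y []]] // in v0 vf vt vt1 vt2 sv *.
move=> _; exists [:: x; y]; split=> //.
have [x0 y0 _] := and3P v0.
have indep p q : x *~ p + y *~ q = 0 -> p = 0 /\ q = 0.
  move=> xy; have p0 : p = 0.
    apply: (vf x [:: y]) => //; exists (- q).
    by apply/eqP; rewrite /= mulrNz opprK xy.
  split=> //; move: xy; rewrite p0 mulr0z add0r => /eqP.
  by rewrite mulrz_eq0 (gt_eqF y0) orbF => /eqP.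
have coord p q p' q' : x *~ p + y *~ q = x *~ p' + y *~ q' -> p = p' /\ q = q'.
  move=> /eqP; rewrite -subr_eq0 sub_comb => /eqP/indep[/eqP + /eqP].
  by rewrite !subr_eq0 => /eqP -> /eqP ->.
have [a [b [a0 b0 t1E]]] := nspan_pair vt1.
have [c [d [c0 d0 t2E]]] := nspan_pair vt2.
have [p [q xE]] : exists p q : int, x = t1 *~ p + t2 *~ q.
  by apply: zspan_pair; apply: (vt _).1; apply: zspan_mem; rewrite inE eqxx.
have [p' [q' yE]] : exists p q : int, y = t1 *~ p + t2 *~ q.
  by apply: zspan_pair; apply: (vt _).1; apply: zspan_mem; rewrite !inE eqxx orbT.
have comb m m' : t1 *~ m + t2 *~ m' = x *~ (a * m + c * m') + y *~ (b * m + d * m').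
  by rewrite t1E t2E !mulrzDl !mulrzDr !mulrzA addrACA.
have [] : 1 = a * p + c * q /\ 0 = b * p + d * q.
  by apply: coord; rewrite -comb -xE mulr1z mulr0z addr0.
have [] : 0 = a * p' + c * q' /\ 1 = b * p' + d * q'.
  by apply: coord; rewrite -comb -yE mulr1z mulr0z add0r.
move=> E1 E2 E3 E4; rewrite t1E t2E; apply: reach_unimodular2 => //.
(* Expressing [x] and [y] back through [t1] and [t2] gives the inverse matrix, so the determinant is
   a unit. *)
have : (a * d - b * c) * (p * q' - q * p') = 1.
  transitivity ((a * p + c * q) * (b * p' + d * q')
    - (a * p' + c * q') * (b * p + d * q)); first by ring.
  by rewrite -E1 -E2 -E3 -E4 mulr0 subr0 mulr1.
move=> /(congr1 absz)/eqP; rewrite abszM muln_eq1 => /andP[+ _].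
by clear; lia.
Qed.

(** * Labelled elements and their defects *)

(* A pair (w, l) carries an element w together with its integer label l. *)
Definition defect (lam : R) (z : R * int) : R := z.2%:~R - lam * z.1.

Definition near lam (K : seq (R * int)) := [/\ zfree (map fst K),
  all (fun z : R * int => 0 < z.1) K & all (fun z => `|defect lam z| < 2^-1) K].

Lemma defectB (lam : R) (z z' : R * int) : defect lam (z - z') = defect lam z - defect lam z'.
Proof. by rewrite /defect /= rmorphB /=; ring. Qed.

Lemma near_perm (lam : R) (K L : seq (R * int)) : perm_eq K L -> near lam K -> near lam L.
Proof.
move=> KL [Kf K0 Kd]; split; rewrite -?(perm_all _ KL) //.
by apply: zfree_perm Kf; apply: perm_map.
Qed.

Lemma near_ge0 (lam : R) (K : seq (R * int)) z : 0 < lam -> near lam K -> z \in K -> 0 <= z.2.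
Proof.
move=> lam0 [_ /allP K0 /allP Kd] zK; have := Kd z zK; have := K0 z zK.
rewrite leNgt ltr_norml /defect => z0 /andP[d0 _]; apply/negP => z2.
have : z.2%:~R <= -1 :> R by rewrite -(intrN _ 1) ler_int; move: z2; clear; lia.
by have : 0 < lam * z.1 by [exact: mulr_gt0]; move: d0; lra.
Qed.

(** Distinct integer labels differ by at least 1, which outweighs two defects below one half. *)
Lemma near_lt (lam : R) z z' : 0 < lam -> `|defect lam z| < 2^-1 ->
  `|defect lam z'| < 2^-1 -> z'.2 < z.2 -> z'.1 < z.1.
Proof.
move=> lam0; rewrite !ltr_norml /defect => /andP[z1 z2] /andP[z'1 z'2].
rewrite -lezD1 -(ler_int R) rmorphD /= => zz'.
by rewrite -(ltr_pM2l lam0); lra.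
Qed.

Lemma same_sign (a b : R) : 0 <= a * b -> `|a| < 2^-1 -> `|b| < 2^-1 ->
  `|a - b| < 2^-1.
Proof.
rewrite !ltr_norml; case: (ltgtP a 0) => [a0|a0|->].
- by rewrite nmulr_rge0 //; lra.
- by rewrite pmulr_rge0 //; lra.
- by lra.
Qed.

(* Subtracting an element of label 0, whose defect is negative, raises the
   defect without changing the label. *)
Lemma slide (lam : R) (y z : R * int) (K : seq (R * int)) :
  0 < lam -> 0 < z.1 -> z.2 = 0 -> 0 < y.2 -> `|defect lam z| < 2^-1 ->
  `|defect lam y| < 2^-1 ->
  exists y' : R * int, [/\ reachL (y :: z :: K) (y' :: z :: K), y'.2 = y.2,
    `|defect lam y'| < 2^-1 & 0 <= defect lam y'].
Proof.
move=> lam0 z0 z2; have lz0 : 0 < lam * z.1 by apply: mulr_gt0.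
(* Each subtraction raises the defect by [lam * z.1], so [k] of them suffice to make it
   nonnegative. *)
have [k] : exists k : nat, - defect lam y <= lam * z.1 *+ k.
  exists (Num.bound (`|defect lam y| / (lam * z.1))).
  have := archi_boundP (divr_ge0 (normr_ge0 (defect lam y)) (ltW lz0)).
  rewrite ltr_pdivrMr // mulr_natl => /ltW; apply: le_trans.
  by rewrite -normrN ler_norm.
elim: k y => [|k IHk] y yk y2 dz dy.
  exists y; split=> //; first exact: reach_refl.
  by move: yk; rewrite mulr0n oppr_le0.
have [y0|yneg] := leP 0 (defect lam y).
  by exists y; split=> //; apply: reach_refl.
have dyz : defect lam (y - z) = defect lam y + lam * z.1.
  by rewrite defectB {2}/defect z2 sub0r opprK.
have [] := IHk (y - z).
- by rewrite dyz; move: yk; rewrite mulrS; lra.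
- by rewrite /= z2 subr0.
- by [].
(* A negative defect raised by less than one half stays below one half. *)
- move: dz dy; rewrite dyz !ltr_norml {1 2}/defect z2; move: yneg lz0; lra.
move=> y' [yy' y'2 dy' dy'0]; exists y'; split=> //; last by rewrite y'2 /= z2 subr0.
apply: reach_trans yy'; apply: reach_step => /=.
by apply: near_lt lam0 dy dz _; rewrite z2.
Qed.

(* Subtracting two elements whose defects have the same sign keeps all defects
   below 1/2, so that labels and values remain ordered alike. Among three elements
   two have defects of the same sign. *)
Lemma concentrate (lam : R) K : 0 < lam -> near lam K -> (2 < size K)%N ->
  has (fun z => z.2 != 0) K ->
  exists z h, [/\ reachL K (z :: h), 0 < z.2 & all (fun z => z.2 == 0) h].
Proof.
move=> lam0; have [N] := ubnP (\sum_(z <- K) `|z.2|)%N.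
elim: N K => // N IHN K.
pose goal L := exists z h,
  [/\ reachL L (z :: h), 0 < z.2 & all (fun z : R * int => z.2 == 0) h].
have goal_reach L M : reachL L M -> goal M -> goal L.
  by move=> LM [z [h [Mz z0 h0]]]; exists z, h; split=> //; apply: reach_trans LM Mz.
(* A single subtraction between two positive labels lowers the sum of the labels, after which the
   induction hypothesis takes over. *)
have step L (x y : R * int) L' : (\sum_(z <- L) `|z.2| < N.+1)%N -> near lam L ->
    (2 < size L)%N -> perm_eq L (x :: y :: L') -> 0 < x.2 -> 0 < y.2 ->
    0 <= defect lam x * defect lam y -> goal L.
  move=> LN Ln L3 Lxy x2 y2 dxy; apply: (goal_reach _ _ (reach_perm _ Lxy)).
  move: x2 y2 dxy.
  move: LN L3; rewrite (perm_big _ Lxy) (perm_size Lxy).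
  move/(near_perm Lxy): Ln => {L Lxy} Ln LN L3.
  wlog yx : x y Ln LN L3 / y.1 < x.1 => [wl x2 y2 xy|].
    have := zfree_neq (let: And3 f _ _ := Ln in f : zfree [:: x.1, y.1 & _]).
    rewrite neq_lt => /orP[xy1|yx]; last exact: wl.
    apply: (goal_reach _ _ (reach_perm _ (perm_swap _ _ _))).
    apply: wl => //; last by rewrite mulrC.
      exact: (near_perm (perm_swap _ _ _)).
    by move: LN; rewrite !big_cons /= addnCA.
  move=> x2 y2 dxy; apply: (goal_reach _ _ (reach_step _ yx)).
  have Ln' : near lam (x - y :: y :: L').
    case: Ln => /= Lf /and3P[x1 y1 L1] /and3P[dx dy dL]; split=> /=.
    - exact: zfree_step.
    - by rewrite subr_gt0 yx y1.
    by rewrite dy dL defectB same_sign.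
  apply: IHN => //=; last by rewrite (gt_eqF y2) orbT.
  have : 0 <= (x - y).2 by apply: (near_ge0 lam0 Ln'); rewrite mem_head.
  move: LN x2 y2; rewrite !big_cons /=.
  by move: (\sum_(z <- L') _)%N x.2 y.2; clear; lia.
move=> KN Kn K3 Knz; rewrite -/(goal K).
set P := filter (fun z : R * int => 0 < z.2) K.
set Z := filter (predC (fun z : R * int => 0 < z.2)) K.
have KPZ : perm_eq K (P ++ Z) by rewrite perm_sym; apply/permPl/perm_filterC.
have P0 z : z \in P -> 0 < z.2 by rewrite mem_filter => /andP[].
have Z0 z : z \in Z -> z.2 = 0.
  rewrite mem_filter /= -leNgt => /andP[z0 zK].
  by apply: le_anti; rewrite z0 (near_ge0 lam0 Kn).
(* Cases by the number of positive labels: none is excluded, one is the goal, two may need a label 0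
   element, and among three two defects have the same sign. *)
case: P => [|x [|y [|z P]]] in KPZ P0.
- case/hasP: Knz => z; rewrite (perm_mem KPZ) => /Z0 ->.
  by rewrite eqxx.
- exists x, Z; split.
  + exact: reach_perm.
  + by apply: P0; rewrite mem_head.
  + by apply/allP => z /Z0 ->.

- have [x2 y2] : 0 < x.2 /\ 0 < y.2.
    by split; apply: P0; rewrite !inE eqxx ?orbT.
  have [|dxy] := leP 0 (defect lam x * defect lam y); first exact: (step K x y Z).
  (* The third element has label 0. Sliding the entry of negative defect along it makes both defects
     nonnegative without changing any label. *)
  have {KPZ} [z [Z' [KE z2]]] : exists z Z',
      perm_eq K [:: x, y, z & Z'] /\ z.2 = 0.
    case: Z KPZ Z0 => [|z Z'] KPZ Z0; last first.
      by exists z, Z'; split=> //; apply: Z0; rewrite mem_head.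
    by move: K3; rewrite (perm_size KPZ).
  wlog dy : x y x2 y2 dxy KE {P0} / defect lam y < 0 => [wl|].
    have [|dy] := ltP (defect lam y) 0; first exact: (wl x y).
    apply: (wl y x) => //; first by rewrite mulrC.
      by rewrite (permPl KE) perm_swap.
    by move: dxy dy; nra.
  have dx : 0 < defect lam x by move: dxy dy; nra.
  have [_ /= ] := near_perm KE Kn.
  move=> /and4P[x1 y1 z1 _] /and4P[dx2 dy2 dz2 _].
  have [y' [yy' y'2 dy'2 dy']] := slide (x :: Z') lam0 z1 z2 y2 dz2 dy2.
  have Kyz : perm_eq K [:: y, z, x & Z'].
    rewrite (permPl KE) -[X in perm_eq X]/([:: x] ++ [:: y; z] ++ Z').
    exact/permPl/perm_catCA.
  apply: (goal_reach _ _ (reach_permL Kyz yy')).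
  apply: (step _ x y' (z :: Z')); rewrite ?y'2 //; last exact: mulr_ge0 (ltW dx) _.
  - by move: KN; rewrite (perm_big _ Kyz) /= !big_cons y'2.
  - have [Kf K0 Kd] := near_perm Kyz Kn.
    have := reach_map (psi := idR) (h := fstR) (fun=> erefl) yy'.
    move=> /reach_zfree/(_ Kf) Kf'; split=> //.
      by have := reach_pos yy' K0.
    by move: Kd => /= /and4P[_ -> -> ->]; rewrite dy'2.
  - by rewrite perm_sym; apply/permPl/(perm_catCA [:: x] [:: y'; z]).
have K3z z' : z' \in [:: x; y; z] -> 0 < z'.2.
  by move=> z'P; apply: P0; move: z'P; rewrite !inE => /or3P[]->; rewrite ?orbT.
have [x2 y2 z2] : [/\ 0 < x.2, 0 < y.2 & 0 < z.2].
  by split; apply: K3z; rewrite !inE eqxx ?orbT.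
have [|dxy] := leP 0 (defect lam x * defect lam y); first exact: (step K x y (z :: P ++ Z)).
have [|dxz] := leP 0 (defect lam x * defect lam z).
  apply: (step K x z (y :: P ++ Z)) => //.
  by rewrite (permPl KPZ) /= perm_cons perm_swap.
apply: (step K y z (x :: P ++ Z)) => //; last by move: dxy dxz; nra.
by rewrite (permPl KPZ); apply/permPl/(perm_catCA [:: x] [:: y; z]).
Qed.

(** * Approximation by labels and induction on the rank *)

(** Pigeonhole: for two multipliers [q1 < q2] the fractional parts of all [q * (x / x0)] lie in the
    same cells of length [1 / N.+1]. Dividing by [x0] gives [x0] itself the label [q2 - q1], which
    is nonzero. *)
Lemma dirichlet s N : all (fun x => 0 < x) s -> s != [::] ->
  exists (v : R -> int) (lam : R), [/\ 0 < lam, has (fun x => v x != 0) s &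
    {in s, forall x, `|(v x)%:~R - lam * x| < N.+1%:R^-1}].
Proof.
case: s => // x0 s /= /andP[x00 s0] _.
pose w x := x / x0; pose m := size (x0 :: s).
pose frac (q : nat) x : R := q%:R * w x - (Num.floor (q%:R * w x))%:~R.
have frac_itv q x : 0 <= frac q x < 1.
  have := floorD1_gt (q%:R * w x); rewrite rmorphD /= => fD1.
  by rewrite /frac subr_ge0 floor_le /= ltrBlDl.
pose cell q x : int := Num.floor (N.+1%:R * frac q x).
have cell_itv q x : 0 <= cell q x < N.+1.
  have /andP[f0 f1] := frac_itv q x; rewrite /cell floor_ge0 mulr_ge0 //=.
  by rewrite floor_lt_int -pmulrn -[ltRHS]mulr1 ltr_pM2l.
pose cells (q : 'I_(N.+1 ^ m).+1) : {ffun 'I_m -> 'I_N.+1} :=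
  [ffun i : 'I_m => inord `|cell q (nth 0 (x0 :: s) i)|].
have : ~~ injectiveb cells.
  apply/injectiveP => /leq_card; rewrite card_ord card_ffun !card_ord.
  by rewrite ltnn.
case/injectivePn => q1 [q2 q12 cq].
wlog lt_q12 : q1 q2 q12 cq / (q1 < q2)%N => [wl|].
  have := q12; rewrite -val_eqE neq_ltn => /orP[]; first exact: (wl q1 q2).
  by apply: (wl q2 q1) => //; rewrite eq_sym.
exists (fun x => Num.floor (q2%:R * w x) - Num.floor (q1%:R * w x)).
exists ((q2%:R - q1%:R) / x0); split.
- by rewrite divr_gt0 // subr_gt0 ltr_nat.
- apply/orP; left; rewrite /w divff ?gt_eqF // !mulr1.
  have fl (q : nat) : Num.floor (q%:R : R) = q by exact: (intrKfloor q).
  rewrite !fl.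
  by move: lt_q12; clear; lia.
move=> x /= xs.
have cE : cell q1 x = cell q2 x.
  have xm : (index x (x0 :: s) < m)%N by rewrite index_mem.
  have := congr1 (fun f : {ffun 'I_m -> 'I_N.+1} => val (f (Ordinal xm))) cq.
  have cell_nat q : (`|cell q x| < N.+1)%N.
    by have := cell_itv q x; move: (cell q x); clear; lia.
  rewrite /= !ffunE !nth_index // !inordK //.
  have := cell_itv q1 x; have := cell_itv q2 x.
  by move: (cell q1 x) (cell q2 x); clear; lia.
have -> : (Num.floor (q2%:R * w x) - Num.floor (q1%:R * w x))%:~R
    - (q2%:R - q1%:R) / x0 * x = frac q1 x - frac q2 x.
  by rewrite /frac rmorphB /= /w; ring.
rewrite -(ltr_pM2l (ltr0Sn R N)) divff ?pnatr_eq0 // -[X in X * _]normr_nat.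
rewrite -normrM mulrBr.
have := floor_itv (N.+1%:R * frac q1 x); have := floor_itv (N.+1%:R * frac q2 x).
rewrite -/(cell q1 x) -/(cell q2 x) cE rmorphD /= ltr_norml => /andP[a b] /andP[c d].
by apply/andP; split; lra.
Qed.

(** The constant depends only on the coefficients of [x], not on the labelling, so it can be fixed
    before the accuracy of the approximation is chosen. *)
Lemma transport s x : zspan s x -> exists C : nat,
  forall (v : R -> int) (lam eps : R),
    {in s, forall y, `|(v y)%:~R - lam * y| <= eps} ->
  exists2 l : int, zspan [seq (y, v y) | y <- s] (x, l) &
    `|l%:~R - lam * x| <= eps *+ C.
Proof.
elim: s x => [|y s IH] x /=.
  move=> ->; exists 0%N => v lam eps _; exists 0 => //.
  by rewrite mulr0 subrr normr0 mulr0n.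
case=> n /IH[C CP]; exists (C + `|n|)%N => v lam eps veps.
have [z zs|l sl lC] := CP v lam eps.
  by apply: veps; rewrite inE zs orbT.
exists (l + v y *~ n).
  exists n; have -> // : (x, l + v y *~ n) - (y, v y) *~ n = (x - y *~ n, l).
  have E : (y, v y) *~ n = (y *~ n, v y *~ n).
    rewrite [LHS]surjective_pairing; congr pair; first exact: (raddfMz fstR).
    exact: (raddfMz (snd : {additive R * int -> int})).
  by rewrite E; congr pair; rewrite /= addrK.
have -> : (l + v y *~ n)%:~R - lam * x
    = (l%:~R - lam * (x - y *~ n)) + ((v y)%:~R - lam * y) *~ n.
  rewrite mulrzz rmorphD rmorphM /= -(mulrzr y) -(mulrzr (_ - _)).
  by ring.
rewrite mulrnDr (le_trans (ler_normD _ _)) // lerD // normrMz -abszE -pmulrn.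
by rewrite lerMn2r veps ?orbT // mem_head.
Qed.

Lemma transport_seq s t : (forall x, x \in t -> zspan s x) -> exists C : nat,
  forall (v : R -> int) (lam eps : R), 0 <= eps ->
    {in s, forall y, `|(v y)%:~R - lam * y| <= eps} ->
  exists2 L : seq (R * int), map fst L = t & {in L, forall p,
    zspan [seq (y, v y) | y <- s] p /\ `|defect lam p| <= eps *+ C}.
Proof.
elim: t => [|x t IH] st.
  by exists 0%N => v lam eps _ _; exists [::].
have [|C1 C1P] := IH; first by move=> y yt; apply: st; rewrite inE yt orbT.
have [C2 C2P] := transport (st x (mem_head _ _)).
exists (C1 + C2)%N => v lam eps eps0 veps.
have [L <- LP] := C1P v lam eps eps0 veps.
have [l sl lC] := C2P v lam eps veps.
exists ((x, l) :: L) => // p; rewrite inE => /orP[/eqP ->|/LP[sp pC]].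
  by split=> //; apply: le_trans lC _; rewrite mulrnDr lerDr mulrn_wge0.
by split=> //; apply: le_trans pC _; rewrite mulrnDr lerDl mulrn_wge0.
Qed.

(** Independence of the first components makes every relation among the pairs trivial, so the span
    of [K] is the graph of a homomorphism. *)
Lemma label_unique (K : seq (R * int)) x l l' : zfree (map fst K) ->
  zspan K (x, l) -> zspan K (x, l') -> l = l'.
Proof.
move=> Kf Kl Kl'; apply/eqP; rewrite -subr_eq0; apply/eqP.
have : zspan K (0, l - l').
  by have := zspanB Kl Kl'; rewrite [_ - _]surjective_pairing /= subrr.
elim: K {x Kl Kl'} (l - l') Kf => [|y K IH] m /= Kf.
  by case.
case=> n; have [nf Kf'] := (zfree_consP _ _).1 Kf.
have yn : y *~ n = (y.1 *~ n, y.2 *~ n).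
  rewrite [LHS]surjective_pairing; congr pair; first exact: (raddfMz fstR).
  exact: (raddfMz (snd : {additive R * int -> int})).
move=> Kn; have n0 : n = 0.
  apply: nf; have := zspanN (zspan_map fstR Kn).
  by rewrite yn /= sub0r opprK.
by move: Kn; rewrite n0 mulr0z subr0; apply: IH.
Qed.

Lemma zspan_label (K : seq (R * int)) x : zspan (map fst K) x ->
  exists l, zspan K (x, l).
Proof.
elim: K x => [|y K IH] x /=; first by move=> ->; exists 0.
case=> n /IH[l Kl]; exists (l + (y *~ n).2); exists n.
rewrite [_ - _]surjective_pairing /= addrK.
by have -> : (y *~ n).1 = y.1 *~ n by exact: (raddfMz fstR).
Qed.

Lemma zspan_zero (h : seq (R * int)) p : all (fun z => z.2 == 0) h -> zspan h p -> p.2 = 0.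
Proof.
move=> /allP h0; elim: h p h0 => [|y h IH] p h0 /=; first by move=> ->.
case=> n /IH; have -> : (p - y *~ n).2 = p.2 - y.2 *~ n.
  by congr (_ - _); exact: (raddfMz (snd : {additive R * int -> int})).
rewrite (eqP (h0 y (mem_head _ _))) mul0rz subr0; apply=> z zh.
by apply: h0; rewrite inE zh orbT.
Qed.

Lemma zspan_top (h : seq (R * int)) z p : all (fun z => z.2 == 0) h ->
  zspan (z :: h) p -> exists2 n, p.2 = z.2 *~ n & zspan h (p - z *~ n).
Proof.
move=> h0 [n hp]; exists n => //; have /eqP := zspan_zero h0 hp.
have -> : (p - z *~ n).2 = p.2 - z.2 *~ n.
  by congr (_ - _); exact: (raddfMz (snd : {additive R * int -> int})).
by rewrite subr_eq0 => /eqP.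
Qed.

(** An element of [h] has label 0, hence coefficient 0 at [z']. Applied in both directions this
    identifies the kernels of the label map. *)
Lemma zero_part (h h' : seq (R * int)) z z' x :
  (forall p, zspan (z :: h) p -> zspan (z' :: h') p) -> 0 < z'.2 ->
  all (fun z => z.2 == 0) h -> all (fun z => z.2 == 0) h' ->
  zspan (map fst h) x -> zspan (map fst h') x.
Proof.
move=> hh' z'0 h0 h'0; apply: zspan_sub => _ /mapP[p ph ->].
have [|n] := zspan_top h'0 (hh' p _); first by apply/zspan_cons/zspan_mem.
rewrite (eqP (allP h0 _ ph)) => /esym/eqP; rewrite mulrz_eq0 (gt_eqF z'0) orbF.
by move=> /eqP ->; rewrite mulr0z subr0; apply: (zspan_map fstR).
Qed.

(** By symmetry [y <= x]. Moves inside [u] make [x - y] a nonnegative combination, whose subtraction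
    turns [x] into [y]. *)
Lemma joinable_top s t u x y : reachR s (x :: u) -> reachR t (y :: u) ->
  zfree u -> all (fun x => 0 < x) [:: x, y & u] -> zspan u (x - y) ->
  joinable s t.
Proof.
wlog yx : s t x y / y <= x => [wl|] sx ty uf u0 uxy.
  have [|/ltW xy] := leP y x; first by move=> yx; apply: (wl s t x y).
  have [||w [tw sw]] := wl t s y x xy ty sx uf.
  - by move: u0 => /= /and3P[-> -> ->].
  - by rewrite -opprB; apply: zspanN.
  - by exists w.
have /= /and3P[x0 y0 u00] := u0.
have [|w uw wxy] := perron uf u00 uxy; first by rewrite subr_ge0.
exists (y :: w); split; last by apply: reach_trans ty (reach_cons _ uw).
apply: reach_trans (reach_trans sx (reach_cons _ uw)) _.
rewrite -[x](subrKC y); apply: reach_subn => //.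
by rewrite /= y0 (reach_pos uw).
Qed.

Theorem bases_joinable s t : size s = size t -> zfree s -> zfree t ->
  all (fun x => 0 < x) s -> all (fun x => 0 < x) t ->
  (forall x, zspan s x <-> zspan t x) -> joinable s t.
Proof.
have [m] := ubnP (size s); elim: m s t => // m IHm s t sm st sf tf s0 t0 sts.
(* [concentrate] needs three elements, so smaller bases are treated directly. *)
have [s3|] := ltnP 2 (size s); last first.
  case: s t => [|s1 [|s2 [|//]]] [|t1 [|t2 [|//]]] // in sm st sf tf s0 t0 sts * => _.
  - by exists [::]; split; apply: reach_refl.
  - exists [:: t1]; split; last exact: reach_refl.
    have -> : s1 = t1; last exact: reach_refl.
    move: s0 t0; rewrite !all_seq1 => s0 t0; apply: join1 => //.
      by apply: (sts _).1; apply: zspan_mem; rewrite mem_head.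
    by apply: (sts _).2; apply: zspan_mem; rewrite mem_head.
  - exact: join2.
have [C CP] : exists C : nat, forall (v : R -> int) (lam eps : R), 0 <= eps ->
    {in s, forall y, `|(v y)%:~R - lam * y| <= eps} ->
    exists2 L : seq (R * int), map fst L = t & {in L, forall p,
      zspan [seq (y, v y) | y <- s] p /\ `|defect lam p| <= eps *+ C}.
  by apply: transport_seq => x xt; apply/sts; apply: zspan_mem.
(* This accuracy keeps the defects below one half on [s] and also on [t], where they may be [C]
   times larger. *)
have [|v [lam [lam0 v0 vlam]]] := @dirichlet s (2 * C.+1) s0.
  by move: s3; case: (s).
pose eps : R := (2 * C.+1).+1%:R^-1.
have eps0 : 0 < eps by rewrite invr_gt0 ltr0n.
have [|L Lt LP] := CP v lam eps (ltW eps0); first by move=> y /vlam /ltW.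
have epsC k : (k <= C.+1)%N -> eps *+ k < 2^-1.
  move=> kC; rewrite -(mulr_natl eps k) /eps ltr_pdivrMr ?ltr0n //.
  rewrite mulrC ltr_pdivlMr // -natrM ltr_nat.
  by move: kC; clear; lia.
pose K := [seq (y, v y) | y <- s].
have Ks : map fst K = s by rewrite -map_comp map_id.
have Kn : near lam K.
  split; rewrite ?Ks //.
    by move: s0; rewrite -{1}Ks all_map.
  apply/allP => _ /mapP[y ys ->]; apply: lt_trans (vlam y ys) _.
  by have := epsC 1%N isT; rewrite mulr1n.
have Ln : near lam L.
  split; rewrite ?Lt //.
    by move: t0; rewrite -{1}Lt all_map.
  apply/allP => p /LP[_ pC]; apply: le_lt_trans pC _.
  exact: epsC.
(* [K] and [L] span the graph of the same homomorphism; the converse inclusion rests on the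
   uniqueness of labels. *)
have LK p : zspan L p -> zspan K p by apply: zspan_sub => q /LP[].
have KL p : zspan K p -> zspan L p.
  apply: zspan_sub => _ /mapP[y ys ->].
  have [|l Ll] := @zspan_label L y.
    by rewrite Lt; apply/sts; apply: zspan_mem.
  suff <- : l = v y by [].
  apply: (@label_unique K y); rewrite ?Ks //; first exact: LK.
  by apply: zspan_mem; apply: (map_f (fun y => (y, v y))).
have Knz : has (fun z => z.2 != 0) K by rewrite has_map.
have Lnz : has (fun z => z.2 != 0) L.
  apply/negPn/negP; rewrite -all_predC => /allP L0.
  have [p pK /eqP[]] := hasP Knz; apply: (@zspan_zero L).
    by apply/allP => q /L0; rewrite /= negbK.
  by apply: KL; apply: zspan_mem.
have szK : size K = size s by rewrite size_map.
have szL : size L = size s by rewrite st -Lt size_map.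
have [||z [h [Kz z0 h0]]] := concentrate lam0 Kn; rewrite ?szK //.
have [||z' [h' [Lz z'0 h'0]]] := concentrate lam0 Ln; rewrite ?szL //.
have zz' p : zspan (z :: h) p <-> zspan (z' :: h') p.
  rewrite -(reach_zspan _ Kz) -(reach_zspan _ Lz).
  by split=> [/KL|/LK].
have := reach_map (psi := idR) (h := fstR) (fun=> erefl) Kz; rewrite Ks => /= sz.
have := reach_map (psi := idR) (h := fstR) (fun=> erefl) Lz; rewrite Lt => /= tz.
have := reach_zfree sz sf; have := reach_zfree tz tf.
move=> /zfree_cons h'f /zfree_cons hf.
have /= /andP[z10 h10] := reach_pos sz s0.
have /= /andP[z'10 h'10] := reach_pos tz t0.
have szh := reach_size sz; have szh' := reach_size tz.
have [||||||x|u [hu h'u]] := IHm (map fst h) (map fst h').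
- by move: sm; rewrite szh.
- by move: szh'; rewrite -st szh => -[].
- exact: hf.
- exact: h'f.
- exact: h10.
- exact: h'10.
- by split; [apply: (@zero_part _ _ z z')|apply: (@zero_part _ _ z' z)] => // p /zz'.
(* The labels of [z] and [z'] are positive and divide each other, hence agree; so [z - z'] lies in
   the kernel, spanned by [h']. *)
have [n zn hn] := zspan_top h'0 ((zz' z).1 (zspan_mem (mem_head _ _))).
have [n' zn' _] := zspan_top h0 ((zz' z').2 (zspan_mem (mem_head _ _))).
have n_gt0 : 0 < n by move: z0; rewrite zn mulrzz pmulr_rgt0.
have n1 : n = 1.
  move: zn z0; rewrite zn' !mulrzz -mulrA => zn z0.
  have /eqP : z.2 * (n' * n - 1) = 0 by rewrite mulrBr mulr1 -zn subrr.
  rewrite mulf_eq0 (gt_eqF z0) subr_eq0 /= => /eqP n'n.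
  move/(congr1 absz)/eqP: n'n; rewrite abszM muln_eq1 => /andP[_].
  by move: n_gt0; clear; lia.
apply: (joinable_top (u := u) (x := z.1) (y := z'.1)).
- exact: reach_trans sz (reach_cons _ hu).
- exact: reach_trans tz (reach_cons _ h'u).
- exact: reach_zfree h'u h'f.
- by rewrite /= z10 z'10 (reach_pos h'u).
- apply/(reach_zspan _ h'u); have := zspan_map fstR hn.
  by rewrite n1 mulr1z.
Qed.

End Join.

(** * Local rings and chains of primes *)

Section LocalRings.
Variable B : comNzRingType.

Lemma ideal_of_closed (S : {pred B}) : idealr_closed S ->
  exists I : idealr B, I =i S.
Proof.
move=> S_ideal; pose I : idealr B := HB.pack S (isIdealr.Build B S S_ideal).
by exists I.
Qed.

Lemma prime_of_closed (S : {pred B}) : idealr_closed S ->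
  prime_idealr_closed S -> exists I : prime_idealr B, I =i S.
Proof.
move=> S_ideal S_prime; pose I : prime_idealr B := HB.pack S
  (isIdealr.Build B S S_ideal) (isPrimeIdealrClosed.Build B S S_prime).
by exists I.
Qed.

(** A proper ideal contains no unit and therefore lies in [m]. *)
Lemma local_ring_units (m : idealr B) :
  (forall x, x \notin m -> exists y, y * x = 1) -> local_ring m.
Proof.
move=> units; have sub_m (I : idealr B) : {subset I <= m}.
  move=> x Ix; apply: contraT => /units[y yx].
  by have := idealMr y Ix; rewrite yx idealr1.
split=> [I mI|m' max_m'] x; last exact: max_m'.
by apply/idP/idP=> [/mI|/sub_m].
Qed.

End LocalRings.

(** * Ideals and prime chains under a surjection *)

Section Quotients.
Variables (B Q : comNzRingType) (pi : {rmorphism B -> Q}) (P : idealr B).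
Hypothesis pi_surj : forall y, exists x, pi x = y.
Hypothesis pi_ker : forall x, (pi x == 0) = (x \in P).

Lemma ideal_preim (J : idealr Q) :
  exists I : idealr B, forall x, (x \in I) = (pi x \in J).
Proof.
have [|I IE] := @ideal_of_closed B [pred x | pi x \in J].
  split; rewrite ?inE ?rmorph0 ?rmorph1 ?rpred0 ?idealr1 // => a x y /=.
  by rewrite !inE rmorphD rmorphM => xJ yJ; rewrite rpredD // idealMr.
by exists I => x; rewrite IE.
Qed.

Lemma prime_preim (J : prime_idealr Q) :
  exists I : prime_idealr B, forall x, (x \in I) = (pi x \in J).
Proof.
have [||I IE] := @prime_of_closed B [pred x | pi x \in J].
- split; rewrite ?inE ?rmorph0 ?rmorph1 ?rpred0 ?idealr1 // => a x y /=.
  by rewrite !inE rmorphD rmorphM => xJ yJ; rewrite rpredD // idealMr.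
- by move=> x y; rewrite !inE rmorphM prime_idealrM.
by exists I => x; rewrite IE.
Qed.

Lemma ideal_im (I : idealr B) : {subset P <= I} ->
  exists J : idealr Q, forall x, (pi x \in J) = (x \in I).
Proof.
move=> PI; pose S : {pred Q} := fun y => `[< exists2 x, x \in I & pi x = y >].
(* Two preimages of one element differ by an element of the kernel [P], which [I] contains. *)
have SE x : (pi x \in S) = (x \in I).
  apply/asboolP/idP => [[x' x'I xx']|xI]; last by exists x.
  rewrite -(subKr x' x) rpredB // PI // -pi_ker rmorphB xx' /=.
  by rewrite subrr.
have [|J JE] := @ideal_of_closed Q S; last by exists J => x; rewrite JE SE.
split; first by rewrite -(rmorph0 pi) SE rpred0.
  by rewrite -(rmorph1 pi) SE idealr1.
move=> a x y; have [{}a <-] := pi_surj a.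
have [{}x <-] := pi_surj x; have [{}y <-] := pi_surj y.
by rewrite -rmorphM -rmorphD !SE => xI yI; rewrite rpredD ?idealMr.
Qed.

Lemma prime_im (I : prime_idealr B) : {subset P <= I} ->
  exists J : prime_idealr Q, forall x, (pi x \in J) = (x \in I).
Proof.
move=> PI; have [J0 J0E] := ideal_im PI.
have [||J JE] := @prime_of_closed Q J0; last by exists J => x; rewrite JE J0E.
- by split=> [||a u v uJ vJ]; rewrite ?rpred0 ?idealr1 // rpredD ?idealMr.
- move=> x y; have [{}x <-] := pi_surj x; have [{}y <-] := pi_surj y.
  by rewrite -rmorphM !J0E prime_idealrM.
Qed.

(** Generation is asked for only modulo [P], so generators lying in [P] may be dropped. *)
Lemma generates_im (d : nat) (g : 'I_d -> B) (I : idealr B) (J : idealr Q) :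
  (forall x, (pi x \in J) = (x \in I)) -> (forall i, g i \in I) ->
  (forall x, x \in I -> exists c : 'I_d -> B, x - \sum_i c i * g i \in P) ->
  generates (fun i => pi (g i)) J.
Proof.
move=> IJ gI gen y; have [{}y <-] := pi_surj y; rewrite IJ; split=> [/gen[c]|[c cy]].
  rewrite -pi_ker rmorphB subr_eq0 => /eqP ->; exists (fun i => pi (c i)).
  by rewrite rmorph_sum; apply: eq_bigr => i _; rewrite rmorphM.
have [c' c'E] := choice (fun i => pi_surj (c i)).
rewrite -IJ cy; have -> : \sum_i c i * pi (g i) = pi (\sum_i c' i * g i).
  by rewrite rmorph_sum; apply: eq_bigr => i _; rewrite rmorphM c'E.
by rewrite IJ rpred_sum // => i _; rewrite idealMr.
Qed.

Lemma generates_mem (d : nat) (g : 'I_d -> B) (I : idealr B) i :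
  generates g I -> g i \in I.
Proof.
move=> gen; apply/gen; exists (fun j => (j == i)%:R).
by rewrite (bigD1 i) //= eqxx mul1r big1 ?addr0 // => j /negPf ->; rewrite mul0r.
Qed.

Lemma noetherian_im : noetherian B -> noetherian Q.
Proof.
move=> Bn J; have [I IJ] := ideal_preim J; have [d [g gen]] := Bn I.
exists d, (fun i => pi (g i)); apply: (@generates_im _ _ I) => // [i|x /gen[c ->]].
  exact: generates_mem.
by exists c; rewrite subrr rpred0.
Qed.

Lemma local_ring_im (m : idealr B) (m' : idealr Q) : {subset P <= m} ->
  (forall x, (pi x \in m') = (x \in m)) ->
  (forall x, x \notin m -> exists y, y * x = 1) -> local_ring m'.
Proof.
move=> Pm m'E units; apply: local_ring_units => y; have [x <-] := pi_surj y.
by rewrite m'E => /units[z zx]; exists (pi z); rewrite -rmorphM zx rmorph1.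
Qed.

(* A chain in the quotient is pulled back and extended downwards. *)
Lemma prime_chain_preim (d e : nat) (p : nat -> prime_idealr B) :
  (forall i, (i < d)%N -> {subset p i <= p i.+1} /\ ~ {subset p i.+1 <= p i}) ->
  p d =i P -> has_prime_chain Q e -> has_prime_chain B (d + e)%N.
Proof.
move=> p_chain pd [q q_chain].
have [q' q'E] := choice (fun i => prime_preim (q i)).
exists (fun i => if (i < d)%N then p i else q' (i - d)%N) => i ide.
have q'S j : (j < e)%N ->
    {subset q' j <= q' j.+1} /\ ~ {subset q' j.+1 <= q' j}.
  move=> /q_chain[qS qN]; split=> [x|].
    by rewrite !q'E; apply: qS.
  move=> q'q'; apply: qN => y; have [x <-] := pi_surj y.
  by rewrite -!q'E; apply: q'q'.
have [id|di] := ltnP i d; last first.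
  by rewrite ltnNge leqW //= subSn //; apply: q'S; rewrite ltn_subLR.
have [i1d|di1] := ltnP i.+1 d; first exact: p_chain.
(* At the junction [p d] is [P], which lies in [q' 0]; strictness is inherited from the lower
   chain. *)
have [pS pN] := p_chain i id; have id1 : i.+1 = d by apply/eqP; rewrite eqn_leq id.
have Pq' j : {subset P <= q' j}.
  by move=> x; rewrite -pi_ker q'E => /eqP ->; rewrite rpred0.
rewrite id1 subnn in pS pN *; split=> [x /pS|qp]; first by rewrite pd; apply: Pq'.
by apply: pN => x; rewrite pd => /(Pq' 0%N)/qp.
Qed.

Lemma prime_chain_im (d : nat) (p : nat -> prime_idealr B) :
  (forall i, (i < d)%N -> {subset p i <= p i.+1} /\ ~ {subset p i.+1 <= p i}) ->
  (forall i, {subset P <= p i}) -> has_prime_chain Q d.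
Proof.
move=> p_chain Pp; have [q qE] := choice (fun i => prime_im (Pp i)).
exists q => i /p_chain[pS pN]; split=> [y|].
  by have [x <-] := pi_surj y; rewrite !qE; apply: pS.
by move=> qq; apply: pN => x; rewrite -!qE; apply: qq.
Qed.

End Quotients.

Lemma ideal_quot_morph (B : comNzRingType) (P : prime_idealr B) :
  exists2 pi : {rmorphism B -> {ideal_quot P}},
    forall y, exists x, pi x = y & forall x, (pi x == 0) = (x \in P).
Proof.
exists (\pi_({ideal_quot P})%qT : {rmorphism B -> {ideal_quot P}}).
  by move=> y; exists (repr y); rewrite /= reprK.
move=> x; rewrite -[in RHS](subr0 x) Quotient.idealrBE.
by rewrite -[in LHS](rmorph0 (\pi_({ideal_quot P})%qT : {rmorphism B -> {ideal_quot P}})).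
Qed.

Lemma fraction_div (D : idomainType) (x : {fraction D}) :
  exists a b : D, b != 0 /\ x = tofrac a / tofrac b.
Proof.
elim/quotW: x => r; exists (frac r).1, (frac r).2; split; first exact: denom_ratioP.
have d0 : tofrac (frac r).2 != 0 by rewrite tofrac_eq0 denom_ratioP.
apply: (canRL (mulfK d0)); unlock tofrac; apply/eqP.
rewrite -[_ * _]/(FracField.mul _ _) !piE /FracField.equivf /= .
by rewrite !numden_Ratio ?oner_neq0 ?mulr1 ?denom_ratioP // mulrC.
Qed.

(** * Algebraic independence along a chain of primes *)

Section MonomialSums.

(* Exponent vectors of length d with entries below M. *)
Fixpoint words (M d : nat) : seq (seq nat) :=
  if d is d'.+1 then [seq j :: E | j <- iota 0 M, E <- words M d'] else [:: [::]].

Lemma size_words M d : size (words M d) = (M ^ d)%N.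
Proof. by elim: d => //= d IH; rewrite size_allpairs size_iota IH expnS. Qed.

Lemma uniq_words M d : uniq (words M d).
Proof.
by elim: d => //= d IH; apply: allpairs_uniq (iota_uniq _ _) IH _ => -[? ?] [? ?] _ _ /= [-> ->].
Qed.

Lemma mem_words M d E : E \in words M d -> size E = d /\ all (fun e => e < M)%N E.
Proof.
elim: d E => [|d IH] E /=; first by rewrite inE => /eqP ->.
case/allpairsP => -[j E'] /= [jM /IH[<- E'M] ->] /=; split=> //.
by move: jM; rewrite mem_iota => /andP[_ ->].
Qed.

(** The variables are indexed by all natural numbers, so dropping the first one is a shift. *)
Fixpoint monom (B : comNzRingType) (x : nat -> B) (E : seq nat) : B :=
  if E is e :: E' then x 0%N ^+ e * monom (fun i => x i.+1) E' else 1.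

Lemma eq_monom (B : comNzRingType) (x y : nat -> B) E :
  (forall i, (i < size E)%N -> x i = y i) -> monom x E = monom y E.
Proof.
elim: E x y => //= e E IH x y xy; rewrite xy //; congr (_ * _).
by apply: IH => i iE; rewrite xy.
Qed.

Lemma rmorph_monom (B C : comNzRingType) (f : {rmorphism B -> C}) x E :
  f (monom x E) = monom (f \o x) E.
Proof.
by elim: E x => [|e E IH] x /=; rewrite ?rmorph1 // rmorphM rmorphXn IH.
Qed.

(* Modulo [p 1] only the terms of lowest degree in [x 0] survive. *)
Lemma chain_independent (k : fieldType) (B : comNzRingType)
    (j : {rmorphism k -> B}) M d (p : nat -> prime_idealr B) (x : nat -> B) :
  (forall i, (i < d)%N -> [/\ {subset p i <= p i.+1}, x i \in p i.+1 & x i \notin p i]) ->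
  forall c : seq nat -> k, \sum_(E <- words M d) j (c E) * monom x E \in p 0%N ->
  forall E, E \in words M d -> c E = 0.
Proof.
elim: d p x => [|d IH] p x px c /=.
  rewrite big_seq1 mulr1 => cp E; rewrite inE => /eqP ->.
  apply/eqP/contraT => c0; have := idealMr (j (c [::])^-1) cp.
  by rewrite -rmorphM mulVf // rmorph1 idealr1.
have [p01 xp1 xp0] := px 0%N isT.
pose S i := \sum_(E <- words M d) j (c (i :: E)) * monom (fun i => x i.+1) E.
have SE : \sum_(E <- [seq i :: E | i <- iota 0 M, E <- words M d])
    j (c E) * monom x E = \sum_(i <- iota 0 M) x 0%N ^+ (i - 0) * S i.
  rewrite big_allpairs_dep; apply: eq_bigr => i _; rewrite subn0 mulr_sumr.
  by apply: eq_bigr => E _; rewrite /= mulrCA.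
(* The induction runs over sums starting at exponent [i0], with [x 0 ^+ i0] already divided out. *)
rewrite SE; have main m i0 :
    \sum_(i <- iota i0 m) x 0%N ^+ (i - i0) * S i \in p 0%N ->
    forall i E, i \in iota i0 m -> E \in words M d -> c (i :: E) = 0.
  elim: m i0 => [|m IHm] i0 //=.
  have -> : \sum_(i <- i0 :: iota i0.+1 m) x 0%N ^+ (i - i0) * S i
      = S i0 + x 0%N * \sum_(i <- iota i0.+1 m) x 0%N ^+ (i - i0.+1) * S i.
    rewrite big_cons subnn mul1r mulr_sumr; congr (_ + _).
    apply: eq_big_seq => i; rewrite mem_iota => /andP[i0i _].
    by rewrite mulrA -exprS subnSK.
  set T := \sum_(i <- _) _ => ST.
  have Sp1 : S i0 \in p 1%N.
    rewrite -(addrK (x 0%N * T) (S i0)); apply: rpredB; first exact: p01.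
    by rewrite mulrC idealMr.
  have c0 := IH (fun i => p i.+1) (fun i => x i.+1) (fun i id => px i.+1 id) _ Sp1.
  have S0 : S i0 = 0.
    by rewrite /S big_seq big1 // => E /c0 ->; rewrite rmorph0 mul0r.
  (* Since [x 0] is outside the prime [p 0], it can be cancelled. *)
  move: ST; rewrite S0 add0r prime_idealrM (negPf xp0) /= => /IHm{}IHm i E.
  by rewrite inE => /orP[/eqP -> /c0//|iM]; apply: IHm.
by move=> /main{}main E /allpairsP[[i E'] [iM EM ->]]; apply: main.
Qed.

End MonomialSums.

(** * Algebraic dependence of n+1 fractions *)

Section Dependence.
Variables (k : fieldType) (n : nat).
Local Notation K := {fraction {mpoly k[n]}}.
Implicit Types a b : nat -> {mpoly k[n]}.

(** The monomial in the fractions [a i / b i], with denominators cleared by the [M]-th power of each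
    [b i]. *)
Fixpoint homogenized M a b (E : seq nat) : {mpoly k[n]} :=
  if E is e :: E' then
    a 0%N ^+ e * b 0%N ^+ (M - e) * homogenized M (fun i => a i.+1) (fun i => b i.+1) E'
  else 1.

Lemma homogenizedE M a b d E : (forall i, b i != 0) -> E \in words M d ->
  tofrac (homogenized M a b E) = monom (fun i => tofrac (a i) / tofrac (b i)) E
    * \prod_(i < d) tofrac (b i) ^+ M.
Proof.
elim: d a b E => [|d IH] a b E b0.
  by rewrite inE => /eqP ->; rewrite /= big_ord0 mulr1 tofrac1.
case/allpairsP => -[j E'] /= [jM /(IH _ (fun i => b i.+1)) E'E ->] /=.
rewrite !tofracM !tofracXn E'E => [|i]; last exact: b0.
rewrite big_ord_recl /= [RHS]mulrACA; congr (_ * _).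
have bM : tofrac (b 0%N) ^+ M = tofrac (b 0%N) ^+ (M - j) * tofrac (b 0%N) ^+ j.
  by rewrite -exprD subnK //; move: jM; rewrite mem_iota => /andP[_ /ltnW].
by rewrite bM expr_div_n mulrCA mulrC mulfVK // expf_neq0 // tofrac_eq0.
Qed.

(** [msize] is the degree plus one, and 0 for the zero polynomial, whence the successors. *)
Let msizeM_deg (p q : {mpoly k[n]}) d e : (msize p <= d.+1)%N ->
  (msize q <= e.+1)%N -> (msize (p * q) <= (d + e).+1)%N.
Proof.
have [->|p0] := eqVneq p 0; first by rewrite mul0r msize0.
have [->|q0] := eqVneq q 0; first by rewrite mulr0 msize0.
rewrite msizeM //; move: (msize p) (msize q) => u v; lia.
Qed.

Let msizeX_deg (p : {mpoly k[n]}) d e : (msize p <= d.+1)%N ->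
  (msize (p ^+ e) <= (e * d).+1)%N.
Proof.
move=> pd; elim: e => [|e IH]; first by rewrite expr0 msize1.
by rewrite exprS mulSn; apply: msizeM_deg.
Qed.

Lemma msize_homogenized M D a b d E :
  (forall i, msize (a i) <= D.+1)%N -> (forall i, msize (b i) <= D.+1)%N ->
  E \in words M d -> (msize (homogenized M a b E) <= (d * (M * D)).+1)%N.
Proof.
elim: d a b E => [|d IH] a b E aD bD.
  by rewrite inE => /eqP ->; rewrite /= msize1.
case/allpairsP => -[j E'] /= [jM E'W ->] /=; rewrite mulSn.
apply: msizeM_deg; last by apply: IH => // i.
have -> : (M * D = j * D + (M - j) * D)%N.
  by rewrite -mulnDl subnKC //; move: jM; rewrite mem_iota => /andP[_ /ltnW].
by apply: msizeM_deg; apply: msizeX_deg.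
Qed.

Let card_bmultinom L : (#|{: 'X_{1..n < L}}| <= L ^ n)%N.
Proof.
have mL (m : 'X_{1..n < L}) i : (m i < L)%N.
  by apply: leq_ltn_trans (bmdeg m); rewrite mdegE (bigD1 i) //= leq_addr.
pose f (m : 'X_{1..n < L}) : {ffun 'I_n -> 'I_L} := [ffun i => Ordinal (mL m i)].
have f_inj : injective f.
  move=> m m' /ffunP mm'; apply/val_inj/mnmP => i.
  by have := congr1 val (mm' i); rewrite !ffunE.
by have := leq_card _ f_inj; rewrite card_ffun !card_ord.
Qed.

(* There are more monomials in n+1 variables with exponents below M than
   monomials in n variables of degree at most a fixed multiple of M. *)
Lemma fraction_dependent (x : nat -> K) : exists M (c : seq nat -> k),
  \sum_(E <- words M n.+1) frac_const k n (c E) * monom x E = 0 /\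
  exists2 E, E \in words M n.+1 & c E != 0.
Proof.
have [a aP] := choice (fun i => fraction_div (x i)).
have [b bP] := choice aP.
pose D := (\max_(i < n.+1) maxn (msize (a i)) (msize (b i)))%N.
(* Beyond the first [n.+1] indices the fraction becomes 0 / 1, so degree bounds and nonvanishing of
   denominators hold for every index. *)
pose a' i := if (i < n.+1)%N then a i else 0.
pose b' i := if (i < n.+1)%N then b i else 1.
have a'D i : (msize (a' i) <= D.+1)%N.
  rewrite /a'; case: ltnP => [iN|_]; last by rewrite msize0.
  apply/leqW/(leq_trans (leq_maxl _ (msize (b i)))).
  exact: (leq_bigmax (Ordinal iN)).
have b'D i : (msize (b' i) <= D.+1)%N.
  rewrite /b'; case: ltnP => [iN|_]; last by rewrite msize1.
  apply/leqW/(leq_trans (leq_maxr (msize (a i)) _)).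
  exact: (leq_bigmax (Ordinal iN)).
have b'0 i : b' i != 0.
  by rewrite /b'; case: ifP => _; [exact: (bP i).1|exact: oner_neq0].
(* Since [L <= M * T] and [T ^ n < M], the at most [L ^ n] columns are fewer than the [M ^ n.+1]
   rows; a vector in the left kernel is the desired relation. *)
pose T := (n.+1 * D).+1; pose M := (T ^ n).+1; pose L := (n.+1 * (M * D)).+1.
pose W := words M n.+1; pose h := homogenized M a' b'.
pose A : 'M[k]_(size W, #|{: 'X_{1..n < L}}|) :=
  \matrix_(i, j) (h (nth [::] W i))@_(bmnm (enum_val j)).
have LMT : (L <= M * T)%N by rewrite /L /T; nia.
have Agt : (#|{: 'X_{1..n < L}}| < size W)%N.
  rewrite size_words; apply: leq_ltn_trans (card_bmultinom L) _.
  apply: leq_ltn_trans (_ : _ <= (M * T) ^ n)%N _; first by elim: (n) => // e IH; rewrite !expnS leq_mul.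
  rewrite expnMn expnS mulnC ltn_pmul2r ?expn_gt0 //.
have kerA : kermx A != 0.
  rewrite kermx_eq0 /row_free neq_ltn; apply/orP; left.
  exact: leq_ltn_trans (rank_leq_col A) Agt.
pose u := nz_row (kermx A).
have u0 : u != 0 by rewrite nz_row_eq0.
have uA : u *m A = 0 by apply/sub_kermxP/nz_row_sub.
pose c E := if insub (index E W) is Some i then u 0 i else 0.
have cE (i : 'I_(size W)) : c (nth [::] W i) = u 0 i.
  by rewrite /c index_uniq ?uniq_words // valK.
exists M, c; split; last first.
  have [i ui] : exists i, u 0 i != 0.
    apply/existsP; apply: contraNT u0; rewrite negb_exists => /forallP u0.
    by apply/eqP/rowP => i; rewrite mxE; apply/eqP/negPn/u0.
  by exists (nth [::] W i); rewrite ?mem_nth // cE.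
have sum0 : \sum_(E <- W) c E *: h E = 0.
  rewrite (big_nth [::]) big_mkord; apply/mpolyP => m.
  rewrite raddf_sum mcoeff0 /=; under eq_bigr do rewrite mcoeffZ cE.
  have [mL|Lm] := ltnP (mdeg m) L.
    move/matrixP/(_ 0 (enum_rank (BMultinom mL))): uA; rewrite !mxE => uA0.
    by rewrite -[RHS]uA0; apply: eq_bigr => i _; rewrite mxE enum_rankK.
  apply: big1 => i _; have hi : (nth [::] W i) \in W by rewrite mem_nth.
  rewrite memN_msupp_eq0 ?mulr0 //; apply: msize_mdeg_ge.
  by apply: leq_trans Lm; apply: msize_homogenized hi.
have den0 : \prod_(i < n.+1) tofrac (b' i) ^+ M != 0.
  by apply/prodf_neq0 => i _; rewrite expf_neq0 // tofrac_eq0.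
apply: (mulIf den0); rewrite mul0r mulr_suml.
transitivity (tofrac (\sum_(E <- W) c E *: h E)); last by rewrite sum0 tofrac0.
rewrite rmorph_sum.
apply: eq_big_seq => E EW; rewrite -mul_mpolyC rmorphM /= (homogenizedE _ b'0 EW) -mulrA.
congr (_ * (_ * _)); apply: eq_monom => i; rewrite (mem_words EW).1 => iN.
by rewrite /a' /b' iN; case: (bP i).
Qed.
End Dependence.

(** * Regularity of the local ring of a point *)

(** Each index is chosen so that [g] is minimal there among all indices beyond the previous
    choice. *)
Lemma nondecreasing_subsequence (g : nat -> nat) : exists f : nat -> nat,
  forall i, (f i < f i.+1)%N /\ (g (f i) <= g (f i.+1))%N.
Proof.
have min_after N : exists m, (N <= m)%N /\ forall j, (N <= j)%N -> (g m <= g j)%N.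
  have [|v /asboolP[m Nm <-] vmin] := @ex_minnP (fun v => `[< exists2 m, (N <= m)%N & g m = v >]).
    by exists (g N); apply/asboolP; exists N.
  exists m; split=> // j Nj; apply: vmin; apply/asboolP.
  by exists j.
have [h hP] := choice min_after.
exists (fun i => iter i (fun m => h m.+1) (h 0%N)) => i /=.
set m := iter i _ _; have mh : (m < h m.+1)%N := (hP m.+1).1.
split=> //; case: i @m mh => [|i] m mh; first exact: (hP 0%N).2.
by apply: (hP _).2; apply: leq_trans (hP _).1 (ltnW mh).
Qed.

(** Subsequences are extracted for one coordinate after another; monotonicity in the earlier
    coordinates survives. *)
Lemma dickson n (f : nat -> 'X_{1..n}) :
  exists i j : nat, (i < j)%N /\ (f i <= f j)%MM.
Proof.
have incr (h : nat -> nat) : (forall i, h i <= h i.+1)%N ->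
    forall i j, (i <= j)%N -> (h i <= h j)%N.
  by move=> hS i j; apply: (homo_leq (r := leq)) => // y x z; apply: leq_trans.
suff [h hP] : exists h : nat -> nat, forall k, (h k < h k.+1)%N /\
    forall i, i \in enum 'I_n -> (f (h k) i <= f (h k.+1) i)%N.
  exists (h 0%N), (h 1%N); split; first exact: (hP _).1.
  by apply/mnm_lepP => i; apply: (hP _).2; rewrite mem_enum.
elim: (enum 'I_n) => [|i s [h hP]]; first by exists id.
have [g gP] := nondecreasing_subsequence (fun k => f (h k) i).
exists (h \o g) => k /=; split.
  apply: leq_trans (hP _).1 _.
  exact: incr (fun l => ltnW (hP l).1) _ _ (gP k).1.
move=> j; rewrite inE => /orP[/eqP ->|js]; first exact: (gP k).2.
apply: (incr (fun k => f (h k) j)) (ltnW (gP k).1) => l.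
exact: (hP l).2.
Qed.

(** * Finite generation of polynomial ideals *)

Section Hilbert.
Variables (k : fieldType) (n : nat).
Local Notation S := {mpoly k[n]}.

Definition combination (s : seq S) (p : S) :=
  exists c : nat -> S, p = \sum_(i < size s) c i * s`_i.

Lemma combination_mem s p : p \in s -> combination s p.
Proof.
move=> ps; have pi : (index p s < size s)%N by rewrite index_mem.
exists (fun i => (i == index p s)%:R).
rewrite (bigD1 (Ordinal pi)) //= eqxx mul1r nth_index // big1 ?addr0 // => i.
by rewrite -val_eqE /= => /negPf ->; rewrite mul0r.
Qed.

Lemma combinationD s a p q : combination s p -> combination s q ->
  combination s (a * p + q).
Proof.
move=> [c ->] [d ->]; exists (fun i => a * c i + d i).
rewrite mulr_sumr -big_split; apply: eq_bigr => i _ /=.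
by rewrite mulrDl mulrA.
Qed.

(** A suitable monomial multiple of [q] cancels the leading term of [p]. *)
Lemma mlead_reduce (p q : S) : p != 0 -> q != 0 -> (mlead q <= mlead p)%MM ->
  exists a, p - a * q = 0 \/ (mlead (p - a * q) < mlead p)%O.
Proof.
move=> p0 q0 qp; pose a := (mleadc p / mleadc q) *: 'X_[mlead p - mlead q].
have lq0 : mleadc q != 0 by rewrite mleadc_eq0.
have lc0 : mleadc p / mleadc q != 0 by rewrite mulf_neq0 ?invr_eq0 ?mleadc_eq0.
have a0 : a != 0 by rewrite -mleadc_eq0 mleadcZE mulf_neq0 // ?mleadZ // mleadXm mcoeffX eqxx oner_neq0.
have aE : mlead a = (mlead p - mlead q)%MM by rewrite mleadZ // mleadXm.
have aqE : mlead (a * q) = mlead p by rewrite mleadM // aE submK.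
exists a; have [->|g0] := eqVneq (p - a * q) 0; [by left|right].
have := mleadB_le p (a * q); rewrite aqE joinxx lt_neqAle => ->; rewrite andbT.
apply: contra g0 => /eqP gp; rewrite -mleadc_eq0 gp mcoeffB.
have -> : (a * q)@_(mlead p) = mleadc a * mleadc q.
  by rewrite -mleadcM aE submK.
by rewrite mleadcZE mleadXm mcoeffX eqxx mulr1 divfK // subrr.
Qed.

(** Otherwise elements outside the ideal of their predecessors, with minimal leading monomial, can
    be chosen forever. By Dickson's lemma one leading monomial divides a later one, and reduction
    contradicts minimality. *)
Lemma mpoly_ideal_finite (J : S -> Prop) :
  J 0 -> (forall a p q, J p -> J q -> J (a * p + q)) ->
  exists2 s : seq S, {in s, forall p, J p} & forall p, J p -> combination s p.
Proof.
move=> J0 JD; apply: contrapT => nofin.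
have next s : exists p, {in s, forall p, J p} -> [/\ J p, ~ combination s p &
    forall q, J q -> ~ combination s q -> ~ (mlead q < mlead p)%O].
  have [Js|?] := pselect {in s, forall p, J p}; last by exists 0.
  have [p0 [Jp0 sp0]] : exists p, J p /\ ~ combination s p.
    apply: contrapT => all_s; apply: nofin; exists s => // p Jp.
    by apply: contrapT => sp; apply: all_s; exists p.
  have [m] : exists m, m = mlead p0 by exists (mlead p0).
  elim/(well_founded_ind (@ltom_wf n)): m p0 Jp0 sp0 => m IH p Jp sp mE.
  have [[q [Jq sq qp]]|min_p] := pselect (exists q, [/\ J q, ~ combination s q & (mlead q < mlead p)%O]).
    by apply: (IH (mlead q) _ q) => //; rewrite mE.
  exists p => _; split=> // q Jq sq qp; apply: min_p.
  by exists q.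
have [F FP] := choice next.
pose s i := iter i (fun s => rcons s (F s)) [::].
have Js i : {in s i, forall p, J p}.
  elim: i => // i IH p; rewrite mem_rcons inE => /orP[/eqP ->|/IH//].
  by have [] := FP _ IH.
have sF i j : (i < j)%N -> F (s i) \in s j.
  elim: j => // j IH; rewrite ltnS leq_eqVlt mem_rcons inE => /orP[/eqP ->|/IH ->].
    by rewrite eqxx.
  by rewrite orbT.
have [i [j [ij lij]]] := dickson (fun i => mlead (F (s i))).
have [JFi sFi _] := FP _ (Js i); have [JFj sFj minj] := FP _ (Js j).
have comb0 u : combination u 0.
  by exists (fun=> 0); rewrite big1 // => l _; rewrite mul0r.
have nz l : ~ combination (s l) (F (s l)) -> F (s l) != 0.
  by move=> sl; apply/eqP => Fl0; apply: sl; rewrite Fl0.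
have [a [g0|glt]] := mlead_reduce (nz _ sFj) (nz _ sFi) lij.
  apply: sFj; move/eqP: g0; rewrite subr_eq0 => /eqP ->.
  by rewrite -[_ * _]addr0; apply: combinationD (comb0 _); apply/combination_mem/sF.
apply: (minj (F (s j) - a * F (s i))) => //.
  by rewrite addrC -mulNr; apply: JD.
move=> sg; apply: sFj; rewrite -(subrK (a * F (s i)) (F (s j))) addrC.
by apply: combinationD sg; apply/combination_mem/sF.
Qed.

End Hilbert.

Section SubringVal.
Variables (K : fieldType) (A : subringClosed K).
Implicit Types x y : subring_of A.

Lemma subring_val0 : val (0 : subring_of A) = 0. Proof. exact: rmorph0. Qed.
Lemma subring_val1 : val (1 : subring_of A) = 1. Proof. exact: rmorph1. Qed.
Lemma subring_valD x y : val (x + y) = val x + val y. Proof. exact: rmorphD. Qed.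
Lemma subring_valB x y : val (x - y) = val x - val y. Proof. exact: rmorphB. Qed.
Lemma subring_valM x y : val (x * y) = val x * val y. Proof. exact: rmorphM. Qed.

End SubringVal.

(** * The localized polynomial ring inside a field *)

Section PolyLocalRing.
Variables (k K : fieldType) (iota : {rmorphism k -> K}) (n : nat) (z : 'I_n -> K).
Local Notation B := (subring_of (poly_local iota z)).
Local Notation S := {mpoly k[n]}.
Local Notation ev := (mmap iota z).

Lemma ev_local (p : S) : ev p \in poly_local iota z.
Proof.
apply/asboolP; exists p, 1; have -> : ev 1 = 1 by exact: rmorph1.
by rewrite mcoeff1 eqxx divr1 !oner_neq0.
Qed.

Definition local_poly (p : S) : B := Sub (ev p) (ev_local p).

Arguments local_poly : simpl never.

Lemma val_local_poly p : val (local_poly p) = ev p.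
Proof. by rewrite SubK. Qed.

Lemma local_poly_morph : zmod_morphism local_poly * monoid_morphism local_poly.
Proof.
split=> [p q|].
  by apply: val_inj; rewrite subring_valB !val_local_poly mmapB.
split=> [|p q]; apply: val_inj; rewrite ?subring_val1 ?subring_valM !val_local_poly.
  exact: rmorph1.
exact: rmorphM.
Qed.

HB.instance Definition _ := GRing.isZmodMorphism.Build S B local_poly
  local_poly_morph.1.
HB.instance Definition _ := GRing.isMonoidMorphism.Build S B local_poly
  local_poly_morph.2.

Lemma local_polyP (w : B) : exists p q : S,
  [/\ q@_0%MM != 0, ev q != 0 & w * local_poly q = local_poly p].
Proof.
have /asboolP[p [q [q0 qz wE]]] := valP w; exists p, q; split=> //.
by apply: val_inj; rewrite subring_valM !val_local_poly wE divfK.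
Qed.

Lemma local_poly_inv (q : S) : q@_0%MM != 0 -> ev q != 0 ->
  exists u : B, u * local_poly q = 1.
Proof.
move=> q0 qz; have uP : (ev q)^-1 \in poly_local iota z.
  apply/asboolP; exists 1, q; split=> //; have -> : ev 1 = 1 by exact: rmorph1.
  by rewrite div1r.
by exists (Sub (ev q)^-1 uP : B); apply: val_inj; rewrite subring_valM val_local_poly SubK mulVf.
Qed.

(** Clearing denominators, which are units, shows that an ideal is generated by the polynomials it
    contains. *)
Lemma poly_local_noetherian : noetherian B.
Proof.
move=> I; have [||s sI sP] := @mpoly_ideal_finite k n (fun p => local_poly p \in I).
- by rewrite rmorph0 rpred0.
- by move=> a p q pI qI; rewrite rmorphD rmorphM rpredD // idealMr.
exists (size s), (fun i => local_poly s`_i) => w; split=> [wI|[c ->]]; last first.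
  by rewrite rpred_sum // => i _; rewrite idealMr // sI // mem_nth.
have [p [q [q0 qz wqp]]] := local_polyP w; have [u uq] := local_poly_inv q0 qz.
have [c pE] : combination s p by apply: sP; rewrite -wqp mulrC idealMr.
exists (fun i => u * local_poly (c i)).
rewrite -[w]mulr1 -uq mulrCA wqp pE rmorph_sum mulr_sumr.
by apply: eq_bigr => i _; rewrite rmorphM mulrA.
Qed.

End PolyLocalRing.

(** * Setting variables to zero *)

Section Kill.
Variables (k : fieldType) (n : nat).
Implicit Types (A : {set 'I_n}) (p q : {mpoly k[n]}).

Definition kill A : {mpoly k[n]} -> {mpoly k[n]} :=
  mmap (@mpolyC n k) (fun i => if i \in A then 0 else 'X_i).

HB.instance Definition _ A := GRing.RMorphism.on (kill A).

Lemma killM A : {morph kill A : p q / p * q}. Proof. exact: rmorphM. Qed.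
Lemma killD A : {morph kill A : p q / p + q}. Proof. exact: rmorphD. Qed.

Lemma killX A i : kill A 'X_i = if i \in A then 0 else 'X_i.
Proof. by rewrite /kill mmapX mmap1U. Qed.

(** A monomial either contains a variable from [A] or is left unchanged. *)
Lemma kill_rest A p : exists r : 'I_n -> {mpoly k[n]},
  p = kill A p + \sum_(i in A) r i * 'X_i.
Proof.
elim/mpolyind: p => [|c m p _ _ [r pE]].
  exists (fun=> 0); rewrite /kill mmap0 big1 ?addr0 // => i _.
  by rewrite mul0r.
have [s sE] : exists s : 'I_n -> {mpoly k[n]},
    'X_[m] = kill A 'X_[m] + \sum_(i in A) s i * 'X_i.
  have [/existsP[i /andP[iA mi]]|noA] := boolP [exists i, (i \in A) && (m i != 0%N)].
    have mE : (m = (m - U_(i)) + U_(i))%MM by rewrite submK // lep1mP.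
    exists (fun j => if j == i then 'X_[m - U_(i)] else 0).
    rewrite {1 2}mE mpolyXD killM killX iA mulr0 add0r (bigD1 i) //= eqxx.
    by rewrite big1 ?addr0 // => j /andP[_ /negPf ->]; rewrite mul0r.
  exists (fun=> 0); rewrite big1 ?addr0 => [|i _]; last by rewrite mul0r.
  rewrite /kill mmapX /mmap1 [LHS]mpolyXE_id; apply: eq_bigr => i _.
  case: ifP => // iA; move: noA; rewrite negb_exists => /forallP/(_ i).
  by rewrite iA /= negbK => /eqP ->; rewrite !expr0.
exists (fun i => c *: s i + r i).
rewrite {1}pE {1}sE killD /kill mmapZ -/(kill A _) mul_mpolyC scalerDr.
rewrite addrACA -/(kill A p); congr (_ + _).
rewrite scaler_sumr -big_split; apply: eq_bigr => i _ /=.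
by rewrite mulrDl scalerAl.
Qed.

Lemma kill_coeff0 A p : (kill A p)@_0%MM = p@_0%MM.
Proof.
have [r pE] := kill_rest A p; rewrite [in RHS]pE mcoeffD.
rewrite [X in _ + X](_ : _ = 0) ?addr0 // raddf_sum big1 //= => i _.
have c0M (f g : {mpoly k[n]}) : (f * g)@_0%MM = f@_0%MM * g@_0%MM.
  exact: rmorphM.
by rewrite c0M mcoeffX mnm1_eq0 mulr0.
Qed.

Lemma kill_sub A A' p : A \subset A' -> kill A p = 0 -> kill A' p = 0.
Proof.
move=> AA' pA; have [r ->] := kill_rest A p; rewrite pA add0r rmorph_sum.
by apply: big1 => i iA; rewrite rmorphM /= killX (subsetP AA') // mulr0.
Qed.

Lemma kill_set0 p : kill set0 p = p.
Proof. by have [r {2}->] := kill_rest set0 p; rewrite big_set0 addr0. Qed.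

Lemma kill_setT p : kill [set: 'I_n] p = (p@_0%MM)%:MP.
Proof.
elim/mpolyind: p => [|c m p _ _ IH]; first by rewrite /kill mmap0 mcoeff0 mpolyC0.
rewrite killD IH mcoeffD mpolyCD /kill mmapZ mmapX mcoeffZ mcoeffX mpolyCM.
congr (_ * _ + _); have [->|m0] := eqVneq m 0%MM; first by rewrite mmap11.
have [i mi] : exists i, m i != 0%N.
  apply/existsP; apply: contraNT m0; rewrite negb_exists => /forallP m0.
  by apply/eqP/mnmP => i; rewrite mnm0E; apply/eqP/negPn/m0.
by rewrite /mmap1 (bigD1 i) //= inE expr0n (negPf mi) mul0r mpolyC0.
Qed.

End Kill.

(** * Primes generated by variables *)

Section CoordinatePrimes.
Variables (k : fieldType) (n : nat) (B : comNzRingType).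
Variable lp : {rmorphism {mpoly k[n]} -> B}.
Hypothesis lp_inj : injective lp.
Hypothesis lp_unit : forall q, q@_0%MM != 0 -> exists u, u * lp q = 1.
Hypothesis lp_frac : forall w, exists p q, q@_0%MM != 0 /\ w * lp q = lp p.
Hypothesis B_noetherian : noetherian B.
Hypothesis B_dim : forall e, has_prime_chain B e -> (e <= n)%N.
Implicit Types (A : {set 'I_n}) (p q : {mpoly k[n]}).

(** The kernel of [kill A], extended to fractions. It is independent of the fraction chosen, since
    [kill A] preserves constant coefficients and so never kills a denominator; it is prime because
    polynomials form a domain. *)
Lemma coord_prime_exists A : exists I : prime_idealr B, forall w p q,
  q@_0%MM != 0 -> w * lp q = lp p -> (w \in I) = (kill A p == 0).
Proof.
pose S : {pred B} := fun w => `[< exists p q,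
  [/\ q@_0%MM != 0, w * lp q = lp p & kill A p = 0] >].
have SE w p q : q@_0%MM != 0 -> w * lp q = lp p -> (w \in S) = (kill A p == 0).
  move=> q0 wqp; apply/asboolP/eqP => [[p' [q' [q'0 wq'p' p'0]]]|pA]; last by exists p, q.
  have pq' : p * q' = p' * q.
    by apply: lp_inj; rewrite !rmorphM -wqp -wq'p'; ring.
  have := congr1 (kill A) pq'; rewrite !killM p'0 mul0r => /eqP.
  rewrite mulf_eq0 => /orP[/eqP//|/eqP q'A].
  by move: q'0; rewrite -(kill_coeff0 A) q'A mcoeff0 eqxx.
have one0 : (1 : {mpoly k[n]})@_0%MM != 0 by rewrite mcoeff1 eqxx oner_neq0.
have c0M p q : (p * q)@_0%MM = p@_0%MM * q@_0%MM by exact: rmorphM.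
have [||I IE] := @prime_of_closed B S; last first.
- by exists I => w p q; rewrite IE; apply: SE.
- move=> u v; have [p [q [q0 uE]]] := lp_frac u.
  have [p' [q' [q'0 vE]]] := lp_frac v.
  rewrite (SE u p q) // (SE v p' q') // (SE (u * v) (p * p') (q * q')).
  - by rewrite killM mulf_eq0.
  - by rewrite c0M mulf_neq0.
  - by rewrite !rmorphM -uE -vE; ring.
split.
- by rewrite (SE 0 0 1) // ?rmorph0 ?mul0r // /kill mmap0.
- rewrite (SE 1 1 1) // ?mul1r //; apply/eqP => /(congr1 (mcoeff 0%MM)).
  by rewrite kill_coeff0 mcoeff0; apply/eqP.
move=> a u v; have [p [q [q0 uE]]] := lp_frac u.
have [p' [q' [q'0 vE]]] := lp_frac v.
have [p'' [q'' [q''0 aE]]] := lp_frac a.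
rewrite (SE u p q) // (SE v p' q') // => /eqP pA /eqP p'A.
rewrite (SE _ (p'' * p * q' + p' * (q'' * q)) (q'' * q * q')).
- by rewrite killD !killM pA p'A mulr0 !mul0r addr0.
- by rewrite !c0M !mulf_neq0.
- by rewrite rmorphD !rmorphM -uE -vE -aE; ring.
Qed.

Definition coord_prime A : prime_idealr B := projT1 (cid (coord_prime_exists A)).

Lemma coord_primeE A w p q : q@_0%MM != 0 -> w * lp q = lp p ->
  (w \in coord_prime A) = (kill A p == 0).
Proof. exact: (projT2 (cid (coord_prime_exists A))). Qed.

Lemma coord_prime_lp A p : (lp p \in coord_prime A) = (kill A p == 0).
Proof.
apply: (@coord_primeE _ _ _ 1); first by rewrite mcoeff1 eqxx oner_neq0.
by rewrite rmorph1 mulr1.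
Qed.

Lemma coord_prime_X A i : (lp 'X_i \in coord_prime A) = (i \in A).
Proof.
rewrite coord_prime_lp killX; case: ifP; rewrite ?eqxx // => _.
apply/eqP => /(congr1 (mcoeff U_(i)%MM)); rewrite mcoeffX eqxx mcoeff0.
by apply/eqP/oner_neq0.
Qed.

Lemma coord_prime_sub A A' : A \subset A' ->
  {subset coord_prime A <= coord_prime A'}.
Proof.
move=> AA' w; have [p [q [q0 wE]]] := lp_frac w.
move=> wA; have := etrans (esym (coord_primeE A q0 wE)) wA => /eqP pA.
by apply: (etrans (coord_primeE A' q0 wE)); apply/eqP/(kill_sub AA').
Qed.

Lemma coord_prime_gen A w : w \in coord_prime A ->
  exists c : 'I_n -> B, w = \sum_(i in A) c i * lp 'X_i.
Proof.
have [p [q [q0 wE]]] := lp_frac w; have [u uq] := lp_unit q0.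
rewrite (coord_primeE _ q0 wE) => /eqP pA; have [r pE] := kill_rest A p.
exists (fun i => u * lp (r i)); rewrite -[w]mulr1 -uq mulrCA wE pE pA add0r.
rewrite rmorph_sum mulr_sumr; apply: eq_bigr => i _.
by rewrite rmorphM mulrA.
Qed.

Lemma coord_prime_setT w : w \notin coord_prime [set: 'I_n] -> exists u, u * w = 1.
Proof.
have [p [q [q0 wE]]] := lp_frac w.
rewrite (coord_primeE _ q0 wE) kill_setT mpolyC_eq0 => /lp_unit[u up].
by exists (u * lp q); rewrite -mulrA [lp q * w]mulrC wE.
Qed.

Lemma coord_prime_set0 w : (w == 0) = (w \in coord_prime set0).
Proof.
have [p [q [q0 wE]]] := lp_frac w; have [u uq] := lp_unit q0.
rewrite (coord_primeE _ q0 wE) kill_set0; apply/eqP/eqP => [w0|p0].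
  by apply: lp_inj; rewrite -wE w0 mul0r rmorph0.
by rewrite -[w]mulr1 -uq mulrCA wE p0 rmorph0 mulr0.
Qed.

(** Variables are added one at a time, and the new variable witnesses strictness. *)
Lemma coord_prime_chain A (s : seq 'I_n) : uniq s -> {in s, forall i, i \notin A} ->
  let p i := coord_prime (A :|: [set j in take i s]) in
  forall i, (i < size s)%N ->
    {subset p i <= p i.+1} /\ ~ {subset p i.+1 <= p i}.
Proof.
move=> s_uniq sA p i si.
have i0 : 'I_n by case: (s) si => // j.
have take_i : take i.+1 s = rcons (take i s) (nth i0 s i) by exact: take_nth.
split.
  apply: coord_prime_sub; apply: setUS; apply/subsetP => j; rewrite !inE take_i.
  by rewrite mem_rcons inE => ->; rewrite orbT.
have Xi m : (lp 'X_(nth i0 s i) \in p m) = (nth i0 s i \in take m s).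
  rewrite /p coord_prime_X !inE (negPf (sA _ _)) ?mem_nth //.
move=> /(_ (lp 'X_(nth i0 s i))); have := take_uniq i.+1 s_uniq.
rewrite take_i rcons_uniq => /andP[/negP Nis _] ppi; apply: Nis.
by rewrite -Xi ppi // Xi take_i mem_rcons mem_head.
Qed.

(* With [pi] the identity and [A] empty this is the regularity of the local ring
   itself. *)
Lemma regular_coord_quotient (Q : comNzRingType) (pi : {rmorphism B -> Q}) A :
  (forall y, exists x, pi x = y) ->
  (forall x, (pi x == 0) = (x \in coord_prime A)) -> regular_local_ring Q.
Proof.
move=> pi_surj pi_ker; split.
  exact: (noetherian_im (P := coord_prime A) pi_surj pi_ker B_noetherian).
have AT : {subset coord_prime A <= coord_prime [set: 'I_n]}.
  by apply: coord_prime_sub; rewrite subsetT.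
have [m mE] := ideal_im pi_surj pi_ker AT.
have cardA : (#|A| + #|~: A| = n)%N by rewrite cardsC card_ord.
exists m, #|~: A|; split.
- exact: (local_ring_im pi_surj AT mE (@coord_prime_setT)).
- split; last first.
    (* A chain in the quotient is preceded in [B] by the chain from 0 to [coord_prime A], of length
       [#|A|]. *)
    move=> e Qe; rewrite -(leq_add2l #|A|) cardA; apply: B_dim.
    have chainA := @coord_prime_chain set0 (enum A) (enum_uniq _) _.
    rewrite cardE; apply: (prime_chain_preim pi_surj pi_ker (chainA _)) Qe => [i|].
      by rewrite inE.
    have AE : set0 :|: [set j in take (size (enum A)) (enum A)] = A.
      by apply/setP => j; rewrite take_size !inE mem_enum.
    by move=> w; apply: (congr1 (fun A' => w \in coord_prime A') AE).
  rewrite cardE; apply: (prime_chain_im pi_surj pi_ker (coord_prime_chain (A := A) (enum_uniq _) _)).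
    by move=> i; rewrite mem_enum inE.
  by move=> i; apply: coord_prime_sub; rewrite subsetUl.
(* Modulo [coord_prime A] the variables outside [A] generate the maximal ideal. *)
exists (fun i => pi (lp 'X_(enum_val i))); apply: (generates_im pi_surj pi_ker mE).
  by move=> i; rewrite coord_prime_X inE.
move=> w /coord_prime_gen[c ->]; exists (fun i => c (enum_val i)).
rewrite (bigID (mem A)) /= -(big_enum_val (fun i => c i * lp 'X_i)) /=.
rewrite [X in _ + X - _](eq_bigl (mem (~: A))); last by move=> i; rewrite !inE.
rewrite addrK rpred_sum // => i /andP[_ iA].
by rewrite idealMr // coord_prime_X.
Qed.

Lemma regular_coord_ring : regular_local_ring B.
Proof.
apply: (@regular_coord_quotient B idfun set0) => [y|w]; first by exists y.
exact: coord_prime_set0.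
Qed.

Lemma coord_prime_regular A : regular_prime (coord_prime A).
Proof.
have [pi pi_surj pi_ker] := ideal_quot_morph (coord_prime A).
exact: regular_coord_quotient pi_surj pi_ker.
Qed.

End CoordinatePrimes.

(** * The local ring of algebraically independent elements *)

Section PolyLocalRegular.
Variables (k K : fieldType) (iota : {rmorphism k -> K}) (n : nat).
Variable z : 'I_n -> K.
Hypothesis z_free : forall p : {mpoly k[n]}, mmap iota z p = 0 -> p = 0.
Local Notation B := (subring_of (poly_local iota z)).
Local Notation lp := (local_poly iota z).
Hypothesis B_dim : forall e, has_prime_chain B e -> (e <= n)%N.

Lemma poly_local_inj : injective lp.
Proof.
move=> p q pq; apply/eqP; rewrite -subr_eq0; apply/eqP/z_free.
by rewrite mmapB -!val_local_poly pq subrr.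
Qed.

Lemma poly_local_unit q : q@_0%MM != 0 -> exists u : B, u * lp q = 1.
Proof.
move=> q0; apply: local_poly_inv => //.
by apply: contraNneq q0 => /z_free ->; rewrite mcoeff0.
Qed.

Lemma poly_local_frac (w : B) : exists p q, q@_0%MM != 0 /\ w * lp q = lp p.
Proof. by have [p [q [q0 _ wE]]] := local_polyP w; exists p, q. Qed.

Lemma poly_local_regular : regular_local_ring B.
Proof.
exact: (regular_coord_ring poly_local_inj poly_local_unit poly_local_frac
  (@poly_local_noetherian _ _ _ _ _) B_dim).
Qed.

Lemma poly_local_coord_prime (A : {set 'I_n}) : exists P : prime_idealr B,
  [/\ regular_prime P, forall i, i \in A -> lp 'X_i \in P &
      forall w, w \in P -> exists c, w = \sum_(i in A) c i * lp 'X_i].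
Proof.
exists (coord_prime poly_local_inj poly_local_frac A); split.
- exact: (coord_prime_regular poly_local_inj poly_local_unit poly_local_frac
    (@poly_local_noetherian _ _ _ _ _) B_dim).
- by move=> i iA; apply: (etrans (coord_prime_X _ _ _ _)).
- by move=> w; apply: (coord_prime_gen poly_local_unit).
Qed.

Lemma poly_local_maximal : exists2 m : idealr B, local_ring m &
  forall w p q, q@_0%MM != 0 -> w * lp q = lp p -> (w \in m) = (p@_0%MM == 0).
Proof.
exists (coord_prime poly_local_inj poly_local_frac [set: 'I_n]).
  apply: local_ring_units => w.
  exact: (coord_prime_setT poly_local_unit).
move=> w p q q0 wE; apply: (etrans (coord_primeE _ _ _ q0 wE)).
by rewrite kill_setT mpolyC_eq0.
Qed.

End PolyLocalRegular.

(** * Bound on the dimension *)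

Section ChainBound.
Variables (k : fieldType) (n : nat).
Local Notation K := {fraction {mpoly k[n]}}.
Local Notation iota := (frac_const k n).
Variable z : 'I_n -> K.
Local Notation B := (subring_of (poly_local iota z)).
Local Notation lp := (local_poly iota z).

(** In a longer chain, elements of [p i.+1] outside [p i] for [i <= n] would be independent by
    [chain_independent], against [fraction_dependent]. *)
Lemma poly_local_chain_bound e : has_prime_chain B e -> (e <= n)%N.
Proof.
case=> p p_chain; rewrite leqNgt; apply/negP => ne.
have next i : exists x : B, (i < e)%N -> x \in p i.+1 /\ x \notin p i.
  have [ie|_] := boolP (i < e)%N; last by exists 0.
  have [_ pN] := p_chain i ie; apply: contrapT => nox; apply: pN => x xp.
  by apply: contraT => xpi; case: nox; exists x.
have [x xP] := choice next.
have [M [c [sum0 [E EW]]]] := fraction_dependent (fun i => val (x i)).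
move/eqP; apply.
apply: (@chain_independent k B (lp \o @mpolyC n k) M n.+1 p x) EW => [i iN|].
  have ie : (i < e)%N by apply: leq_trans iN ne.
  by have [? ?] := xP i ie; have [? _] := p_chain i ie.
suff -> : \sum_(E <- words M n.+1) (lp \o @mpolyC n k) (c E) * monom x E = 0.
  exact: rpred0.
apply: val_inj; rewrite subring_val0 -[RHS]sum0.
rewrite (rmorph_sum (val : {rmorphism B -> K})); apply: eq_bigr => E' _.
rewrite rmorphM; congr (_ * _); last exact: rmorph_monom.
exact: etrans (val_local_poly iota z _) (mmapC z iota _).
Qed.

End ChainBound.

(** * Monoidal transforms along a valuation *)

Section Valuation.
Variables (K : fieldType) (RR : realType) (nu : real_valuation K RR).
Implicit Types x y : K.

(** [fine] sends the infinite value of 0 to the real number 0, hence the nonvanishing hypotheses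
    below. *)
Definition value_of x : RR := fine (nu x).
Local Notation v := value_of.

Lemma nuE x : x != 0 -> nu x = (v x)%:E.
Proof. by move=> /(valuation_fin nu)/fineK. Qed.

Lemma vM x y : x != 0 -> y != 0 -> v (x * y) = v x + v y.
Proof. by move=> x0 y0; rewrite /v valuationM !nuE. Qed.

Lemma v1 : v 1 = 0.
Proof. by apply: (addrI (v 1)); rewrite -vM ?oner_neq0 // mulr1 addr0. Qed.

Lemma vV x : x != 0 -> v x^-1 = - v x.
Proof.
move=> x0; apply/eqP; rewrite -subr_eq0 opprK -vM ?invr_eq0 //.
by rewrite mulVf // v1.
Qed.

Lemma vX x m : x != 0 -> v (x ^+ m) = v x *+ m.
Proof.
move=> x0; elim: m => [|m IH]; first by rewrite expr0 v1 mulr0n.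
by rewrite exprS vM ?expf_neq0 // IH mulrS.
Qed.

Lemma v_prod (I : eqType) (r : seq I) (F : I -> K) :
  (forall i, F i != 0) -> v (\prod_(i <- r) F i) = \sum_(i <- r) v (F i).
Proof.
move=> F0; elim: r => [|i r IH]; first by rewrite !big_nil v1.
by rewrite !big_cons vM ?IH // prodf_seq_neq0; apply/allP => j _; rewrite F0.
Qed.

Lemma vN x : v (- x) = v x.
Proof.
have [->|x0] := eqVneq x 0; first by rewrite oppr0.
have N10 : -1 != 0 :> K by rewrite oppr_eq0 oner_neq0.
have vN1 : v (-1) = 0.
  have /eqP : v (-1) + v (-1) = 0 by rewrite -vM // mulrNN mulr1 v1.
  by rewrite -mulr2n mulrn_eq0 /= => /eqP.
by rewrite -mulN1r vM // vN1 add0r.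
Qed.

Lemma vD_ge x y : x != 0 -> y != 0 -> x + y != 0 ->
  Num.min (v x) (v y) <= v (x + y).
Proof.
move=> x0 y0 xy0; have := valuationD nu x y; rewrite !nuE //.
by rewrite -EFin_min lee_fin.
Qed.

(** If [x + y] had larger value than [x], then so would [x = (x + y) - y]. *)
Lemma vD_lt x y : x != 0 -> y != 0 -> v x < v y ->
  x + y != 0 /\ v (x + y) = v x.
Proof.
move=> x0 y0 xy; have xy0 : x + y != 0.
  by apply: contraTneq xy => /eqP; rewrite addr_eq0 => /eqP ->; rewrite vN ltxx.
split=> //; apply/eqP; rewrite eq_le; apply/andP; split; last first.
  by apply: le_trans (vD_ge x0 y0 xy0); rewrite le_min lexx ltW.
rewrite leNgt; apply/negP => lt_v.
have := @vD_ge (x + y) (- y) xy0; rewrite oppr_eq0 addrK vN => /(_ y0 x0).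
by rewrite leNgt lt_min lt_v xy.
Qed.

Lemma nu_gt0 x : x != 0 -> (0 < nu x)%E = (0 < v x).
Proof. by move=> x0; rewrite nuE // lte_fin. Qed.

Lemma nu_ge0 x : x != 0 -> (0 <= nu x)%E = (0 <= v x).
Proof. by move=> x0; rewrite nuE // lee_fin. Qed.

Lemma nu_gt0D x y : (0 < nu x)%E -> (0 < nu y)%E -> (0 < nu (x + y)%R)%E.
Proof. by move=> x0 y0; apply: lt_le_trans (valuationD nu x y); rewrite lt_min x0. Qed.

Lemma nu_gt0M x y : (0 <= nu x)%E -> (0 < nu y)%E -> (0 < nu (x * y)%R)%E.
Proof.
have [->|x0] := eqVneq x 0; first by rewrite mul0r valuation0 lt0y.
have [->|y0] := eqVneq y 0; first by rewrite mulr0 valuation0 lt0y.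
rewrite nu_ge0 // !nu_gt0 ?mulf_neq0 // vM //.
by move=> ? ?; rewrite ltr_wpDl.
Qed.

Lemma in_valuation_ring x : (x \in valuation_ring nu) = (0 <= nu x)%E.
Proof. by []. Qed.

Lemma valuation_maximal : exists2 m : idealr (subring_of (valuation_ring nu)),
  local_ring m & forall w, (w \in m) = (0 < nu (val w))%E.
Proof.
have nu1 : nu 1 = 0%E by rewrite nuE ?oner_neq0 // v1.
have [|m mE] := @ideal_of_closed (subring_of (valuation_ring nu))
    [pred w | (0 < nu (val w))%E].
  split; rewrite ?inE ?subring_val0 ?subring_val1 ?valuation0 ?lt0y ?nu1 ?ltxx //.
  move=> a x y; rewrite !inE subring_valD subring_valM => x0 y0.
  by apply: nu_gt0D => //; apply: nu_gt0M => //; rewrite -in_valuation_ring (valP a).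
exists m => [|w]; last by rewrite mE.
apply: local_ring_units => w; rewrite mE inE => w0.
have wge0 : (0 <= nu (val w))%E by rewrite -in_valuation_ring (valP w).
have wn0 : val w != 0 by apply: contraNneq w0 => ->; rewrite valuation0 lt0y.
have wV : (val w)^-1 \in valuation_ring nu.
  rewrite in_valuation_ring nu_ge0 ?invr_eq0 // vV // oppr_ge0 leNgt.
  by rewrite -nu_gt0.
exists (Sub (val w)^-1 wV : subring_of (valuation_ring nu)).
by apply: val_inj; rewrite subring_valM SubK mulVf // subring_val1.
Qed.

End Valuation.

(** * Polynomials in elements of independent values *)

Section Monomials.
Variables (k K : fieldType) (iota : {rmorphism k -> K}) (n : nat).
Variables (RR : realType) (nu : real_valuation K RR).
Hypothesis nu_iota : forall c, c != 0 -> nu (iota c) = 0%E.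
Implicit Types (z : 'I_n -> K) (p q : {mpoly k[n]}).
Local Notation v := (value_of nu).

Definition independent_values z := (forall i, z i != 0) /\
  (forall i, 0 < v (z i)) /\ rationally_independent (fun i => v (z i)).

Variable z : 'I_n -> K.
Hypothesis z_indep : independent_values z.
Let z0 := z_indep.1.
Let vz0 := z_indep.2.1.
Let z_free := z_indep.2.2.
Local Notation ev := (mmap iota z).

Let weight (m : 'X_{1..n}) : RR := \sum_i v (z i) *+ m i.

Let mmap1_neq0 m : mmap1 z m != 0.
Proof. by apply/prodf_neq0 => i _; rewrite expf_neq0. Qed.

Let v_mmap1 m : v (mmap1 z m) = weight m.
Proof.
rewrite v_prod => [|i]; last by rewrite expf_neq0.
by apply: eq_bigr => i _; rewrite vX.
Qed.

Let weight_inj : injective weight.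
Proof.
move=> m m' /eqP; rewrite -subr_eq0 => /eqP mm'; apply/mnmP => i.
apply/eqP; rewrite -(eqr_nat rat) -subr_eq0; apply/eqP.
apply: (z_free (c := fun i => (m i)%:R - (m' i)%:R)); rewrite -[RHS]mm'.
rewrite /weight -sumrB; apply: eq_bigr => j _.
by rewrite rmorphB /= !ratr_nat mulrBl !mulr_natl.
Qed.

Let v_term c m : c != 0 -> iota c * mmap1 z m != 0 /\ v (iota c * mmap1 z m) = weight m.
Proof.
move=> c0; have ic0 : iota c != 0 by rewrite fmorph_eq0.
rewrite mulf_neq0 // vM // v_mmap1; split=> //.
by rewrite {1}/value_of nu_iota // add0r.
Qed.

(* The values of distinct monomials are distinct, so no cancellation occurs. *)
Lemma value_mmap p : p != 0 -> ev p != 0 /\ exists2 m, m \in msupp p & v (ev p) = weight m.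
Proof.
rewrite -msupp_eq0 /mmap; have := msupp_uniq p.
have : {in msupp p, forall m, p@_m != 0} by move=> m; rewrite mcoeff_msupp.
elim: (msupp p) => // m s IH sp; rewrite cons_uniq => /andP[ms s_uniq] _.
case: s => [|m' s] in IH sp ms s_uniq *.
  have [tm0 vtm] := @v_term p@_m m (sp m (mem_head _ _)).
  by rewrite big_seq1; split=> //; exists m; rewrite ?mem_head.
have [|||S0 [l ls vS]] := IH; rewrite ?s_uniq //.
  by move=> l ls; apply: sp; rewrite inE ls orbT.
have [tm0 vtm] := @v_term p@_m m (sp m (mem_head _ _)).
rewrite big_cons; set S := \sum_(i <- _) _ in S0 vS *.
have lm : weight m != weight l.
  by apply/eqP => /weight_inj ml; move: ms; rewrite ml ls.
have [lt_ml|lt_lm] : weight m < weight l \/ weight l < weight m.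
  by move: lm; rewrite neq_lt => /orP[]; [left|right].
  have [|? vE] := vD_lt (nu := nu) tm0 S0; first by rewrite vtm vS.
  by split=> //; exists m; rewrite ?mem_head // vE.
rewrite addrC; have [|? vE] := vD_lt (nu := nu) S0 tm0; first by rewrite vtm vS.
by split=> //; exists l; rewrite ?vE // inE ls orbT.
Qed.

Lemma indep_free p : ev p = 0 -> p = 0.
Proof. by move=> /eqP evp; apply: contraTeq evp => /value_mmap[]. Qed.

Let weight_ge0 m : 0 <= weight m.
Proof. by apply: sumr_ge0 => i _; rewrite mulrn_wge0 // ltW. Qed.

Lemma nu_ev_gt0 p : p@_0%MM = 0 -> (0 < nu (ev p))%E.
Proof.
have [->|p0] := eqVneq p 0; first by rewrite mmap0 valuation0 lt0y.
move=> pc; have [evp0 [m mp vm]] := value_mmap p0.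
rewrite nu_gt0 // vm lt_neqAle weight_ge0 andbT eq_sym.
have : m != 0%MM by apply: contraTneq mp => ->; rewrite mcoeff_msupp pc eqxx.
apply: contra => /eqP m0; apply/eqP/weight_inj; rewrite m0 /weight big1 // => i _.
by rewrite mnm0E mulr0n.
Qed.

(** The constant term has value 0 and dominates the rest, whose value is positive. *)
Lemma nu_ev_eq0 q : q@_0%MM != 0 -> ev q != 0 /\ nu (ev q) = 0%E.
Proof.
move=> qc; have ic0 : iota q@_0%MM != 0 by rewrite fmorph_eq0.
have vi : v (iota q@_0%MM) = 0 by rewrite /value_of nu_iota.
have qE : ev q = iota q@_0%MM + ev (q - (q@_0%MM)%:MP).
  by rewrite mmapB mmapC addrCA subrr addr0.
have [r0|r0] := eqVneq (ev (q - (q@_0%MM)%:MP)) 0.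
  by rewrite qE r0 addr0 ic0 nuE // vi.
have [|] := @vD_lt _ _ nu _ _ ic0 r0.
  rewrite vi -nu_gt0 //; apply: nu_ev_gt0.
  by rewrite mcoeffB mcoeffC eqxx mulr1 subrr.
by rewrite -qE vi => ? vq; rewrite nuE // vq.
Qed.

Lemma nu_ev_ge0 p : (0 <= nu (ev p))%E.
Proof.
have [p0|p0] := eqVneq p@_0%MM 0; first exact/ltW/nu_ev_gt0.
by rewrite (nu_ev_eq0 p0).2.
Qed.

Lemma nu_ev_gt0E p : (0 < nu (ev p))%E = (p@_0%MM == 0).
Proof.
have [p0|p0] := eqVneq p@_0%MM 0; first exact/nu_ev_gt0.
by rewrite (nu_ev_eq0 p0).2 ltxx.
Qed.

Lemma poly_localP w : reflect
  (exists p q, q@_0%MM != 0 /\ w = ev p / ev q) (w \in poly_local iota z).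
Proof.
apply: (iffP (asboolP _)) => [[p [q [q0 _ ->]]]|[p [q [q0 ->]]]].
  by exists p, q.
by exists p, q; split=> //; have [] := nu_ev_eq0 q0.
Qed.

Lemma nu_local p q : q@_0%MM != 0 -> nu (ev p / ev q) = nu (ev p).
Proof.
move=> q0; have [evq0 nuq] := nu_ev_eq0 q0.
rewrite valuationM [nu (ev q)^-1]nuE ?invr_eq0 // vV // /value_of nuq /=.
by rewrite oppr0 adde0.
Qed.

Lemma poly_local_val : {subset poly_local iota z <= valuation_ring nu}.
Proof.
move=> w /poly_localP[p [q [q0 ->]]].
by rewrite in_valuation_ring nu_local // nu_ev_ge0.
Qed.

Lemma poly_local_inv w : w \in poly_local iota z -> ~ (0 < nu w)%E ->
  w^-1 \in poly_local iota z.
Proof.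
case/poly_localP => p [q [q0 ->]]; rewrite nu_local // nu_ev_gt0E => p0.
by apply/poly_localP; exists q, p; rewrite invf_div; split=> //; apply/negP.
Qed.

(** Reduces inclusions of local rings to generators: denominators have value 0, so [A] contains
    their inverses. *)
Lemma poly_local_least (A : subringClosed K) : (forall c, iota c \in A) ->
  (forall i, z i \in A) ->
  (forall w, w \in A -> nu w = 0%E -> w^-1 \in A) ->
  {subset poly_local iota z <= A}.
Proof.
move=> iA zA AV; have evA p : ev p \in A.
  rewrite rpred_sum // => m _; rewrite rpredM // rpred_prod // => i _.
  by rewrite rpredX.
move=> w /poly_localP[p [q [q0 ->]]]; rewrite rpredM //.
by apply: AV => //; have [] := nu_ev_eq0 q0.
Qed.

Lemma poly_local_const c : iota c \in poly_local iota z.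
Proof. by rewrite -(mmapC z iota); apply: ev_local. Qed.

Lemma poly_local_var i : z i \in poly_local iota z.
Proof.
by have := ev_local iota z 'X_i; rewrite mmapX mmap1U.
Qed.

End Monomials.

(** * A single monoidal transform *)

Section Transforms.
Variables (RR : realType) (k K : fieldType) (iota : {rmorphism k -> K}) (n : nat).
Variable nu : real_valuation K RR.
Hypothesis nu_iota : forall c, c != 0 -> nu (iota c) = 0%E.
Hypothesis PL_dim : forall (z : 'I_n -> K) e,
  has_prime_chain (subring_of (poly_local iota z)) e -> (e <= n)%N.
Implicit Types (z : 'I_n -> K) (p q : {mpoly k[n]}).
Local Notation v := (value_of nu).
Local Notation PL := (poly_local iota).
Local Notation indep := (independent_values nu).

Let const_PL z c : iota c \in PL z. Proof. exact: poly_local_const. Qed.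
Let var_PL z i : z i \in PL z. Proof. exact: poly_local_var. Qed.

Lemma poly_local_sub z z' : indep z -> indep z' -> (forall i, z i \in PL z') ->
  {subset PL z <= PL z'}.
Proof.
move=> zi zi' zz'; apply: (poly_local_least nu_iota zi) => // w wz' w0.
by apply: (poly_local_inv nu_iota zi') => //; rewrite w0 ltxx.
Qed.

Lemma poly_local_dominated z : indep z -> dominates (valuation_ring nu) (PL z).
Proof.
move=> zi; split; first exact: (poly_local_val nu_iota zi).
have z_free := indep_free nu_iota zi.
have [mA mA_local mAE] := poly_local_maximal z_free.
have [mB mB_local mBE] := valuation_maximal nu.
exists mA, mB; split=> // a b ab; rewrite mBE -ab.
have [p [q [q0 evq0 aE]]] := local_polyP a.
have valE : val a = mmap iota z p / mmap iota z q.
  apply: (canRL (mulfK evq0)).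
  by have := congr1 val aE; rewrite subring_valM !val_local_poly.
by rewrite (mAE _ _ _ q0 aE) valE (nu_local nu_iota zi) // (nu_ev_gt0E nu_iota zi).
Qed.

Lemma quotient_field_sub (A A' : subringClosed K) : {subset A <= A'} ->
  has_quotient_field A -> has_quotient_field A'.
Proof.
move=> AA' Aq w; have [a [b [b0 ->]]] := Aq w.
exists (Sub (val a) (AA' _ (valP a))), (Sub (val b) (AA' _ (valP b))).
by rewrite !SubK.
Qed.

Definition monoidal_vars z i j : 'I_n -> K :=
  fun l => if l == i then z i / z j else z l.

Lemma monoidal_vars_indep z i j : indep z -> i != j -> v (z j) < v (z i) ->
  indep (monoidal_vars z i j).
Proof.
rewrite /monoidal_vars => -[z0 [vz0 z_ind]] ij vji; split=> [l|].
  by case: (l =P i) => [_|//]; rewrite mulf_neq0 ?invr_eq0.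
split=> [l|c]; first by case: (l =P i) => // _; rewrite vM ?vV ?invr_eq0 // subr_gt0.
(* Dividing [z i] by [z j] moves [- c i] into the coefficient of [z j]. *)
pose c' l := if l == j then c j - c i else c l.
have -> : \sum_l ratr (c l) * v (if l == i then z i / z j else z l)
    = \sum_l ratr (c' l) * v (z l).
  rewrite (bigD1 i) //= [RHS](bigD1 i) //= eqxx vM ?vV ?invr_eq0 //.
  rewrite (bigD1 j) 1?eq_sym //= [in RHS](bigD1 j) 1?eq_sym //=.
  rewrite /c' eqxx (negPf ij) eq_sym (negPf ij) rmorphB /= !addrA.
  congr (_ + _); first by ring.
  by apply: eq_bigr => l /andP[/negPf -> /negPf ->].
move=> /z_ind c'0; have ci : c i = 0 by have := c'0 i; rewrite /c' (negPf ij).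
move=> l; have [->|lj] := eqVneq l j.
  by have := c'0 j; rewrite /c' eqxx ci subr0.
by have := c'0 l; rewrite /c' (negPf lj).
Qed.

Lemma nu_ge_div (x y : K) : y != 0 -> (0 <= nu (x / y)%R)%E -> (nu y <= nu x)%E.
Proof.
move=> y0; have [->|x0] := eqVneq x 0; first by rewrite valuation0 leey.
rewrite nu_ge0 ?mulf_neq0 ?invr_eq0 // vM ?invr_eq0 // vV // subr_ge0.
by rewrite !nuE // lee_fin.
Qed.

Lemma monoidal_vars_sub z i j : indep z -> i != j -> v (z j) < v (z i) ->
  {subset PL z <= PL (monoidal_vars z i j)}.
Proof.
move=> zi ij vji; have zi' := monoidal_vars_indep zi ij vji.
apply: poly_local_sub => // l; have := @var_PL (monoidal_vars z i j); rewrite /monoidal_vars => z'P.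
have [->|li] := eqVneq l i; last by have := z'P l; rewrite (negPf li).
have := rpredM (z'P i) (z'P j); rewrite eqxx eq_sym (negPf ij) divfK //.
exact: zi.1.
Qed.

(** The centre is the prime generated by [z i] and [z j], and [z j] is its element of least
    value. *)
Lemma monoidal_vars_transform z i j : indep z -> has_quotient_field (PL z) ->
  i != j -> v (z j) < v (z i) ->
  monoidal_transform nu (PL z) (PL (monoidal_vars z i j)).
Proof.
move=> zi zq ij vji; have zi' := monoidal_vars_indep zi ij vji.
have sub := monoidal_vars_sub zi ij vji.
have z0 := zi.1; set z' := monoidal_vars z i j in zi' sub *.
have z_free := indep_free nu_iota zi; have z'_free := indep_free nu_iota zi'.
split=> //; [|exact: poly_local_dominated| |].
- exact: (poly_local_regular z_free (PL_dim (z := z))).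
- exact: (poly_local_regular z'_free (PL_dim (z := z'))).
have [P [P_regular PX Pgen]] := poly_local_coord_prime z_free (PL_dim (z := z)) [set i; j].
have valX l : val (local_poly iota z 'X_l) = z l.
  by rewrite val_local_poly mmapX mmap1U.
(* With [A] the valuation ring this gives minimality of [z j]; with [A] the new local ring it shows
   that the blowup lies inside. *)
have genA (A : subringClosed K) : {subset PL z <= A} -> z i / z j \in A ->
    forall g, g \in P -> val g / z j \in A.
  move=> zA zijA g /Pgen[c ->]; rewrite big_setU1 ?inE // big_set1.
  rewrite subring_valD !subring_valM !valX mulrDl -!mulrA divff // mulr1.
  have cA l : val (c l) \in A by apply: zA; apply: valP.
  exact: rpredD (rpredM (cA i) zijA) (cA j).
have zij : z i / z j \in PL z' by have := var_PL z' i; rewrite /z' /monoidal_vars eqxx.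
exists P, (local_poly iota z 'X_j); rewrite valX; split=> //.
- split; last by apply: PX; rewrite !inE eqxx orbT.
  by apply: contraNneq (z0 j) => /(congr1 val); rewrite valX subring_val0 => ->.
- move=> g gP; apply: nu_ge_div => //.
  apply: (genA (valuation_ring nu)) gP; first exact: (poly_local_val nu_iota zi).
  exact: (poly_local_val nu_iota zi').
(* Polynomials in the new variables lie in the blowup, and denominators have value 0. Conversely,
   elements of the new local ring without positive value are units there. *)
move=> w; split=> [/(poly_localP nu_iota zi')[p [q [q0 ->]]]|[a [b [aP bP b0 ->]]]].
  have blow r : blowup_ring P (local_poly iota z 'X_j) (mmap iota z' r).
    move=> A zA PA; have z'A l : z' l \in A.
      rewrite /z' /monoidal_vars; case: eqP => _; last by apply/zA/var_PL.
      have := PA (local_poly iota z 'X_i); rewrite !valX; apply.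
      by apply: PX; rewrite !inE eqxx.
    rewrite rpred_sum // => m _; rewrite rpredM //; first exact/zA/const_PL.
    by rewrite rpred_prod // => l _; rewrite rpredX.
  exists (mmap iota z' p), (mmap iota z' q); split=> //.
  by rewrite (nu_ev_eq0 nu_iota zi' q0).2 ltxx.
have z'P u : blowup_ring P (local_poly iota z 'X_j) u -> u \in PL z'.
  by apply=> // g; rewrite valX; apply: genA.
apply: rpredM; first exact: z'P.
by apply: (poly_local_inv nu_iota zi') => //; apply: z'P.
Qed.

End Transforms.

Lemma monoidal_product_eqr (K : fieldType) (RR : realType)
    (nu : real_valuation K RR) (A A1 A2 : subringClosed K) :
  monoidal_product nu A A1 -> A1 =i A2 -> monoidal_product nu A A2.
Proof.
elim=> {A A1} [A A1 AA1|A A1 A3 AA1 _ IH] A12.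
  by apply: monoidal_nil => x; rewrite AA1 A12.
exact: monoidal_cons AA1 (IH A12).
Qed.

(** * Laurent monomials and their values *)

Section LaurentMonomials.
Variables (K : fieldType) (n : nat) (y : 'I_n -> K).
Hypothesis y0 : forall i, y i != 0.

Definition laurent (c : 'I_n -> int) : K := \prod_i y i ^ c i.

Lemma laurent_neq0 c : laurent c != 0.
Proof. by apply/prodf_neq0 => i _; rewrite expfz_neq0. Qed.

Lemma laurentD c d : laurent (fun i => c i + d i) = laurent c * laurent d.
Proof.
by rewrite /laurent -big_split; apply: eq_bigr => i _; rewrite /= expfzDr.
Qed.

Lemma laurentM c m : laurent (fun i => c i * m) = laurent c ^ m.
Proof.
rewrite /laurent; elim: (index_enum 'I_n) => [|i r IH].
  by rewrite !big_nil exp1rz.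
by rewrite !big_cons IH expfzMl exprz_exp.
Qed.

Lemma laurentV c : laurent (fun i => - c i) = (laurent c)^-1.
Proof.
by rewrite -exprN1 -laurentM;
  apply: eq_bigr => i _; rewrite mulrN1.
Qed.

Lemma laurent_sum (I : finType) (c : I -> 'I_n -> int) :
  laurent (fun l => \sum_i c i l) = \prod_i laurent (c i).
Proof.
rewrite [RHS]exchange_big; apply: eq_bigr => l _ /=.
elim: (index_enum I) => [|i r IH]; first by rewrite !big_nil expr0z.
by rewrite !big_cons expfzDr ?IH.
Qed.

Lemma laurent_delta i : laurent (fun l => (l == i)%:Z) = y i.
Proof.
rewrite /laurent (bigD1 i) //= eqxx expr1z big1 ?mulr1 // => l /negPf ->.
by rewrite expr0z.
Qed.

Variables (RR : realType) (nu : real_valuation K RR).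
Local Notation v := (value_of nu).

Lemma vXz x (m : int) : x != 0 -> v (x ^ m) = v x *~ m.
Proof.
move=> x0; case: m => m; first by rewrite -pmulrn -exprnP vX.
by rewrite NegzE -exprnN vV ?expf_neq0 // vX // mulrNz -pmulrn.
Qed.

Lemma v_laurent c : v (laurent c) = \sum_i v (y i) *~ c i.
Proof.
rewrite v_prod => [|i]; last by rewrite expfz_neq0.
by apply: eq_bigr => i _; rewrite vXz.
Qed.

Lemma rat_independent_int (t : 'I_n -> RR) : rationally_independent t ->
  forall c : 'I_n -> int, \sum_i t i *~ c i = 0 -> forall i, c i = 0.
Proof.
move=> t_ind c tc i; apply/eqP; rewrite -(intr_eq0 rat); apply/eqP.
apply: (t_ind (fun i => (c i)%:~R)); rewrite -[RHS]tc; apply: eq_bigr => j _.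
by rewrite ratr_int mulrzl.
Qed.

Lemma laurent_inj c d : rationally_independent (fun i => v (y i)) ->
  v (laurent c) = v (laurent d) -> laurent c = laurent d.
Proof.
move=> y_ind; rewrite !v_laurent => /eqP; rewrite -subr_eq0 -sumrB => /eqP cd.
have {}cd i : c i = d i.
  apply/eqP; rewrite -subr_eq0; apply/eqP.
  apply: (rat_independent_int y_ind (c := fun i => c i - d i)).
  by rewrite -[RHS]cd; apply: eq_bigr => j _; rewrite mulrzBr.
by apply: eq_bigr => i _; rewrite cd.
Qed.

Lemma zfree_values : rationally_independent (fun i => v (y i)) ->
  zfree [seq v (y i) | i <- enum 'I_n].
Proof.
set t := fun i => v (y i) => t_ind x s; rewrite -/t => xs m sm.
have : x \in [seq t i | i <- enum 'I_n] by rewrite (perm_mem xs) mem_head.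
case/mapP => i _ xE.
have srem : perm_eq s [seq t l | l <- rem i (enum 'I_n)].
  rewrite -(perm_cons x) -(permPl xs) {1}xE.
  by apply: (perm_map t (t := i :: _)); apply: perm_to_rem; rewrite mem_enum.
(* The coefficient at [i] vanishes because only the values of the other indices are used. *)
have [c [ci cE]] : exists c : 'I_n -> int, c i = 0 /\ x *~ m = \sum_l t l *~ c l.
  move: (x *~ m) sm => w; move/(zspan_perm _ srem).
  have : i \notin rem i (enum 'I_n) by rewrite mem_rem_uniqF ?enum_uniq.
  elim: (rem i _) w => [|j r IH] w; rewrite ?inE ?negb_or /=.
    by move=> _ ->; exists (fun=> 0); rewrite big1 // => l _; rewrite mulr0z.
  move=> /andP[ij /IH{}IH] [e /IH[c [ci wE]]].
  exists (fun l => c l + (l == j)%:Z * e); rewrite (negPf ij) mul0r addr0; split=> //.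
  under eq_bigr do rewrite mulrzDr.
  rewrite big_split /= -wE (bigD1 j) //= eqxx mul1r big1 ?addr0 ?subrK // => l /negPf ->.
  by rewrite mul0r mulr0z.
have := rat_independent_int t_ind (c := fun l => c l - (l == i)%:Z * m).
have -> : \sum_l t l *~ (c l - (l == i)%:Z * m) = 0.
  under eq_bigr do rewrite mulrzBr.
  rewrite sumrB -cE (bigD1 i) //= eqxx mul1r big1 ?addr0 ?xE ?subrr // => l /negPf ->.
  by rewrite mul0r mulr0z.
by move=> /(_ erefl i); rewrite ci eqxx mul1r sub0r => /eqP; rewrite oppr_eq0 => /eqP.
Qed.

End LaurentMonomials.

(** * Subtraction moves as monoidal transforms *)

Section ReachTransforms.
Variables (RR : realType) (k K : fieldType) (iota : {rmorphism k -> K}) (n : nat).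
Variable nu : real_valuation K RR.
Hypothesis nu_iota : forall c, c != 0 -> nu (iota c) = 0%E.
Hypothesis PL_dim : forall (z : 'I_n -> K) e,
  has_prime_chain (subring_of (poly_local iota z)) e -> (e <= n)%N.
Implicit Types (z : 'I_n -> K).
Local Notation v := (value_of nu).
Local Notation PL := (poly_local iota).
Local Notation indep := (independent_values nu).
Local Notation values z := [seq v (z i) | i <- enum 'I_n].

(** Each move is realized at the two indices carrying the values involved. [G] transports a property
    stable under division, later that of being a Laurent monomial in [y]. *)
Lemma reach_monoidal_product (G : K -> Prop) s u z :
  (forall a b, G a -> G b -> G (a / b)) -> (forall i, G (z i)) ->
  reach (idfun : {additive RR -> RR}) s u -> perm_eq s (values z) ->
  indep z -> has_quotient_field (PL z) ->
  exists z', [/\ indep z', perm_eq u (values z'), forall i, G (z' i),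
    {subset PL z <= PL z'} & monoidal_product nu (PL z) (PL z')].
Proof.
move=> Gdiv Gz su; elim: su z Gz => {s u} [s u su|s t u x y sxy yx _ IH] z Gz sz zi zq.
  exists z; split=> //; last exact: monoidal_nil.
  by rewrite -(permPl su).
have xz : perm_eq (x :: y :: t) (values z) by rewrite -(permPl sxy).
have : x \in values z by rewrite -(perm_mem xz) mem_head.
case/mapP => i _ xE.
have en_i := perm_to_rem (mem_enum 'I_n i : i \in enum 'I_n).
set r1 := rem i _ in en_i.
have yt : perm_eq (y :: t) [seq v (z l) | l <- r1].
  by rewrite -(perm_cons x) {2}xE (permPl xz) (perm_map _ en_i).
have : y \in [seq v (z l) | l <- r1] by rewrite -(perm_mem yt) mem_head.
case/mapP => j jr yE.
have r1_j := perm_to_rem jr; set r2 := rem j _ in r1_j.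
have tE : perm_eq t [seq v (z l) | l <- r2].
  by rewrite -(perm_cons y) {2}yE (permPl yt) (perm_map _ r1_j).
have en_ij : perm_eq (enum 'I_n) [:: i, j & r2].
  by rewrite (permPl en_i) perm_cons.
have := enum_uniq 'I_n; rewrite (perm_uniq en_ij) /= inE negb_or.
case/andP => /andP[ij ir2] /andP[jr2 _].
have vji : v (z j) < v (z i) by rewrite -xE -yE.
have zi' := monoidal_vars_indep zi ij vji.
have sub := monoidal_vars_sub nu_iota zi ij vji.
have tr := monoidal_vars_transform nu_iota PL_dim zi zq ij vji.
have [||z' [z'i uz' Gz' zz' zpz']] :=
    IH (monoidal_vars z i j) _ _ zi' (quotient_field_sub sub zq).
- by move=> l; rewrite /monoidal_vars; case: eqP => _; rewrite ?Gz //; apply: Gdiv.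
- rewrite perm_sym (permPl (perm_map _ en_ij)) /= /monoidal_vars eqxx.
  rewrite eq_sym (negPf ij) vM ?vV ?invr_eq0 ?zi.1 // -xE -yE !perm_cons.
  rewrite perm_sym (permPl tE); apply/permP => a; congr (count a _).
  by apply/eq_in_map => l lr; case: eqP => // li; rewrite -li lr in ir2.
exists z'; split=> //; first by move=> w /sub/zz'.
exact: monoidal_cons tr zpz'.
Qed.

End ReachTransforms.

(** * Quotient fields *)

Section QuotientField.
Variables (k K : fieldType) (iota : {rmorphism k -> K}) (n : nat).
Variables (x y : 'I_n -> K) (C : 'I_n -> 'I_n -> int).
Local Notation PL := (poly_local iota x).

Let F w := exists a b, [/\ a \in PL, b \in PL, b != 0 & w = a / b].

Let F_PL a : a \in PL -> F a.
Proof. by move=> ax; exists a, 1; rewrite rpred1 oner_neq0 divr1. Qed.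

Let F1 : F 1. Proof. exact/F_PL/rpred1. Qed.

Let FD a b : F a -> F b -> F (a + b).
Proof.
move=> [p [q [pA qA q0 ->]]] [p' [q' [p'A q'A q'0 ->]]].
exists (p * q' + p' * q), (q * q'); rewrite mulf_neq0 ?addf_div //.
by split=> //; [apply: rpredD; apply: rpredM|apply: rpredM].
Qed.

Let FM a b : F a -> F b -> F (a * b).
Proof.
move=> [p [q [pA qA q0 ->]]] [p' [q' [p'A q'A q'0 ->]]].
exists (p * p'), (q * q'); rewrite mulf_neq0 ?mulf_div //.
by split=> //; apply: rpredM.
Qed.

Let FV a : F a -> F a^-1.
Proof.
move=> [p [q [pA qA q0 ->]]]; have [->|p0] := eqVneq p 0.
  by rewrite mul0r invr0; apply/F_PL/rpred0.
by exists q, p; rewrite invf_div.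
Qed.

Let FX a m : F a -> F (a ^+ m).
Proof.
by move=> Fa; elim: m => [|m IH]; [exact: F1|rewrite exprS; apply: FM].
Qed.

(** The fractions form a field containing the constants and the Laurent monomials in [x], hence
    every [y j], and these generate [K]. *)
Lemma quotient_field_laurent :
  (forall w, exists p q, mmap iota y q != 0 /\ w = mmap iota y p / mmap iota y q) ->
  (forall j, y j = laurent x (C j)) -> has_quotient_field PL.
Proof.
move=> y_gen yx.
have Fy j : F (y j).
  rewrite yx; apply: big_ind => [|//|i _]; first exact: F1.
  have Fx : F (x i) by apply/F_PL/poly_local_var.
  by case: (C j i) => m; rewrite ?NegzE -?exprnP -?exprnN; [exact: FX|exact/FV/FX].
have Fp p : F (mmap iota y p).
  apply: big_ind => [|//|m _]; first exact/F_PL/rpred0.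
  apply: FM; first exact/F_PL/poly_local_const.
  by apply: big_ind => [|//|i _]; [exact: F1|exact/FX/Fy].
move=> w; have [p' [q' [_ ->]]] := y_gen w.
have [p [q [pA qA q0 ->]]] := FM (Fp p') (FV (Fp q')).
by exists (Sub p pA), (Sub q qA); rewrite !SubK.
Qed.

End QuotientField.

Section Fractions.
Variables (k : fieldType) (n : nat) (y : 'I_n -> {fraction {mpoly k[n]}}).
Hypothesis yE : forall j, y j = tofrac 'X_j.
Local Notation iota := (frac_const k n).

Lemma mmap_tofrac (p : {mpoly k[n]}) : mmap iota y p = tofrac p.
Proof.
rewrite [in RHS](mpolyE p) rmorph_sum; apply: eq_bigr => m _.
rewrite -mul_mpolyC rmorphM; congr (_ * _); rewrite mpolyXE_id rmorph_prod.
by apply: eq_bigr => i _; rewrite rmorphXn yE.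
Qed.

Lemma fraction_mmap w : exists p q : {mpoly k[n]},
  mmap iota y q != 0 /\ w = mmap iota y p / mmap iota y q.
Proof.
have [a [b [b0 ->]]] := fraction_div w.
by exists a, b; rewrite !mmap_tofrac tofrac_eq0.
Qed.

End Fractions.

(** * Joining the two local rings *)

Section JoinTransforms.
Variables (RR : realType) (k K : fieldType) (iota : {rmorphism k -> K}) (n : nat).
Variable nu : real_valuation K RR.
Hypothesis PL_dim : forall (z : 'I_n -> K) e,
  has_prime_chain (subring_of (poly_local iota z)) e -> (e <= n)%N.
Implicit Types (y x z : 'I_n -> K).
Local Notation v := (value_of nu).
Local Notation PL := (poly_local iota).
Local Notation indep := (independent_values nu).
Local Notation values z := [seq v (z i) | i <- enum 'I_n].

(** A nonzero constant and its inverse both have nonnegative value. *)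
Lemma dominated_const y : {subset PL y <= valuation_ring nu} ->
  forall c, c != 0 -> nu (iota c) = 0%E.
Proof.
move=> PLV c c0; have ge d : (0 <= nu (iota d))%E.
  by rewrite -in_valuation_ring; apply/PLV/poly_local_const.
have ic0 : iota c != 0 by rewrite fmorph_eq0.
have := ge c^-1; rewrite fmorphV nu_ge0 ?invr_eq0 // vV // oppr_ge0 => le0.
have := ge c; rewrite nu_ge0 // => ge0.
by rewrite nuE //; congr EFin; apply/eqP; rewrite eq_le le0.
Qed.

(** Values are nonnegative by inclusion in the valuation ring, and a zero value would be a rational
    relation. *)
Lemma dominated_indep y : (forall j, y j != 0) ->
  {subset PL y <= valuation_ring nu} ->
  rationally_independent (fun i => v (y i)) -> indep y.
Proof.
move=> y0 PLV y_ind; split=> //; split=> // j; rewrite lt_neqAle.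
rewrite -nu_ge0 // -in_valuation_ring PLV ?poly_local_var // andbT eq_sym.
apply/eqP => vy0.
have := rat_independent_int y_ind (c := fun l => (l == j)%:Z).
rewrite (bigD1 j) //= vy0 mul0rz add0r big1 => [/(_ erefl j)|l /negPf ->].
  by rewrite eqxx.
by rewrite mulr0z.
Qed.

Lemma laurent_mulmx y (A B : 'M[int]_n) i : (forall j, y j != 0) ->
  laurent (fun l => laurent y (A l)) (B i) = laurent y ((B *m A) i).
Proof.
move=> y0; rewrite [LHS]/laurent; under eq_bigr do rewrite -laurentM //.
rewrite -laurent_sum //; apply: eq_bigr => l _; rewrite mxE; congr (_ ^ _).
by apply: eq_bigr => j _; rewrite mulrC.
Qed.

(** A zero value would force a zero row in [A]; a rational relation is multiplied by the inverse
    matrix. *)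
Lemma laurent_indep y (A : 'M[int]_n) : A \in unitmx ->
  (forall i l, 0 <= A i l) -> indep y -> indep (fun i => laurent y (A i)).
Proof.
move=> uA A0 [y0 [vy0 y_ind]]; split=> [i|]; first exact: laurent_neq0.
split=> [i|c].
  rewrite v_laurent // lt_neqAle sumr_ge0 => [|l _]; last first.
    by rewrite mulrz_ge0 // ltW.
  rewrite andbT eq_sym; apply/eqP => /(rat_independent_int y_ind) Ai.
  have := congr1 (fun B : 'M_n => B i i) (mulmxV uA).
  rewrite !mxE eqxx big1 => [/eqP|l _]; first by rewrite eq_sym oner_eq0.
  by rewrite Ai mul0r.
under eq_bigr => i _ do rewrite v_laurent // mulr_sumr.
rewrite exchange_big /=.
have -> : \sum_l \sum_i ratr (c i) * (v (y l) *~ A i l)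
    = \sum_l ratr (\sum_i c i * (A i l)%:~R) * v (y l).
  apply: eq_bigr => l _; rewrite rmorph_sum mulr_suml; apply: eq_bigr => i _.
  by rewrite rmorphM /= ratr_int -[RHS]mulrA; congr (_ * _); rewrite mulrzl.
move=> /y_ind cA i.
have {}cA : (\row_i c i) *m map_mx intr A = 0.
  by apply/rowP => l; rewrite !mxE -[RHS](cA l); apply: eq_bigr => j _; rewrite !mxE.
have := congr1 (fun B => B *m map_mx intr (invmx A)) cA.
rewrite -mulmxA -map_mxM mulmxV // map_mx1 mulmx1 mul0mx => /rowP/(_ i).
by rewrite !mxE.
Qed.

Lemma zspan_laurent z c : (forall i, z i != 0) ->
  zspan (values z) (v (laurent z c)).
Proof.
move=> z0; rewrite v_laurent //; apply: big_ind => [|w w'|i _].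
- exact: zspan0.
- exact: zspanD.
by apply/zspanMz/zspan_mem/map_f; rewrite mem_enum.
Qed.

Lemma zspan_laurent_sub x y (A : 'M[int]_n) w : (forall j, y j != 0) ->
  (forall i, x i = laurent y (A i)) ->
  zspan (values x) w -> zspan (values y) w.
Proof.
move=> y0 xE; apply: zspan_sub => _ /mapP[i _ ->].
by rewrite xE; apply: zspan_laurent.
Qed.

(** Laurent monomials in [y] with equal values are equal, so comparing values suffices. *)
Lemma poly_local_values_sub y z z' : (forall w, w != 0 -> nu (iota w) = 0%E) ->
  indep y -> indep z -> indep z' ->
  (forall i, exists c, z i = laurent y c) -> (forall i, exists c, z' i = laurent y c) ->
  {subset values z <= values z'} -> {subset PL z <= PL z'}.
Proof.
move=> nu_iota [y0 [_ y_ind]] zi zi' zy z'y zz'.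
apply: (poly_local_sub nu_iota zi zi') => i.
have /mapP[j _ vij] : v (z i) \in values z'.
  by apply/zz'/map_f; rewrite mem_enum.
have [[c zE] [d z'E]] := (zy i, z'y j).
have -> : z i = z' j by rewrite zE z'E; apply: (laurent_inj y0 y_ind); rewrite -zE -z'E.
exact: poly_local_var.
Qed.

Theorem monomial_transforms_joinable (a : 'M[nat]_n) y x :
  map_mx Posz a \in unitmx -> (forall j, y j != 0) ->
  (forall w, exists p q, mmap iota y q != 0 /\ w = mmap iota y p / mmap iota y q) ->
  (forall i, x i = \prod_j y j ^+ a i j) ->
  {subset PL y <= valuation_ring nu} ->
  rationally_independent (fun i => v (y i)) ->
  exists T : subringClosed K,
    [/\ regular_local_ring (subring_of T), dominates (valuation_ring nu) T,
        {subset PL x <= PL y} /\ {subset PL y <= T},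
        monoidal_product nu (PL x) T & monoidal_product nu (PL y) T].
Proof.
set A := map_mx Posz a => uA y0 y_gen xa PLV y_ind.
have nu_iota := dominated_const PLV.
have yi := dominated_indep y0 PLV y_ind.
have xE i : x i = laurent y (A i).
  by rewrite xa; apply: eq_bigr => j _; rewrite mxE.
have yy j : y j = laurent y ((1%:M : 'M[int]_n) j).
  rewrite -[LHS](laurent_delta y); apply: eq_bigr => l _.
  by rewrite mxE eq_sym pmulrn intz.
have yE j : y j = laurent x (invmx A j).
  have -> : x = fun i => laurent y (A i) by apply/funext.
  by rewrite laurent_mulmx // mulVmx // -yy.
have xi : indep x.
  have -> : x = fun i => laurent y (A i) by apply/funext.
  by apply: laurent_indep => // i l; rewrite mxE.
have x0 := xi.1.
have xq := quotient_field_laurent y_gen yE.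
have yq := quotient_field_laurent y_gen yy.
have xy : {subset PL x <= PL y}.
  apply: (poly_local_sub nu_iota xi yi) => i; rewrite xa rpred_prod // => j _.
  by rewrite rpredX // poly_local_var.
have pos z : indep z -> all (fun w => 0 < w) (values z).
  by move=> [_ [vz _]]; apply/allP => _ /mapP[i _ ->].
(* Both systems are Laurent monomials in each other because [A] is invertible over the integers. *)
have xyspan w : zspan (values x) w <-> zspan (values y) w.
  by split; apply: zspan_laurent_sub => //; exact: laurent_neq0.
have [|u [xu yu]] := bases_joinable _ (zfree_values xi.2.2)
  (zfree_values y_ind) (pos x xi) (pos y yi) xyspan; first by rewrite !size_map.
pose G w := exists c, w = laurent y c.
have Gdiv w w' : G w -> G w' -> G (w / w').
  move=> [c ->] [d ->]; exists (fun i => c i + - d i).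
  by rewrite laurentD // laurentV.
have [|z [zi uz Gz xz xzp]] :=
    reach_monoidal_product nu_iota PL_dim Gdiv _ xu (perm_refl _) xi xq.
  by move=> i; exists (A i).
have [|z' [z'i uz' Gz' yz' yzp']] :=
    reach_monoidal_product nu_iota PL_dim Gdiv _ yu (perm_refl _) yi yq.
  by move=> i; exists ((1%:M : 'M[int]_n) i).
(* Both sequences of transforms end with the same values, hence with the same local ring. *)
have zz' : perm_eq (values z) (values z') by rewrite -(permPl uz).
have subz'z : {subset PL z' <= PL z}.
  apply: (@poly_local_values_sub y) => // w.
  by rewrite (perm_mem zz').
have subzz' : {subset PL z <= PL z'}.
  apply: (@poly_local_values_sub y) => // w.
  by rewrite (perm_mem zz').
exists (PL z); split=> //.
- exact: (poly_local_regular (indep_free nu_iota zi) (PL_dim (z := z))).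
- exact: poly_local_dominated.
- by split=> // w /yz'/subz'z.
- apply: monoidal_product_eqr yzp' _ => w.
  by apply/idP/idP; [exact: subz'z|exact: subzz'].
Qed.

End JoinTransforms.

Theorem theorem3p1 (RR : realType) (k : fieldType) (n : nat)
    (a : 'M[nat]_n)
    (y x : 'I_n -> {fraction {mpoly k[n]}})
    (nu : real_valuation {fraction {mpoly k[n]}} RR)
    (hdet : \det (map_mx Posz a) = 1 \/ \det (map_mx Posz a) = -1)
    (hy : forall j, y j = tofrac ('X_j : {mpoly k[n]}))
    (hx : forall i, x i = \prod_(j < n) y j ^+ a i j)
    (hrank : rank_one nu)
    (hdom : dominates (valuation_ring nu)
              (poly_local (frac_const k n) y))
    (hind : rationally_independent (fun i => fine (nu (y i)))) :
  exists T : subringClosed {fraction {mpoly k[n]}},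
    [/\ regular_local_ring (subring_of T),
        dominates (valuation_ring nu) T,
        {subset poly_local (frac_const k n) x <= poly_local (frac_const k n) y} /\
        {subset poly_local (frac_const k n) y <= T},
        monoidal_product nu (poly_local (frac_const k n) x) T &
        monoidal_product nu (poly_local (frac_const k n) y) T].
Proof.
apply: (monomial_transforms_joinable _ _ _ _ hx hdom.1 hind).
- by move=> z e; apply: poly_local_chain_bound.
- by rewrite unitmxE; case: hdet => ->; rewrite ?unitrN unitr1.
- by move=> j; rewrite hy tofrac_eq0 -msupp_eq0 msuppX.
- exact: fraction_mmap hy.
Qed.
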